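(* Let $M$ be a smooth manifold with a regular (constant-rank), non-integrable distribution $Q$. Let $c:I=[a,b]\to M$ be an immersed curve tangent to $Q$ which is an integral curve of a vector field $X\in\Gamma(Q)$ defined on a neighbourhood of $\operatorname{Im}(c)$. Then $c$ is an abnormal extremal if and only if $c^*_aQ\neq T_{c(a)}M$.
   Context: All manifolds are real, Hausdorff, second countable and $C^\infty$. A curve is a smooth map from a closed interval admitting a smooth extension to an open interval; it is tangent to $Q$ if $\dot c(t)\in Q_{c(t)}$ for all $t$. $Q^0\subset T^*M$ is the annihilator of $Q$. Let $\{\phi_s\}$ be the local flow of $X$, so $\phi_s(c(t))=c(t+s)$. For $t\in I$ define the linear subspace of $T_{c(t)}M$ $$c^*_tQ=\mathrm{Span}\{T\phi_{-s}(Y)\mid Y\in Q_{c(t+s)},\ s\in[a-t,b-t]\}.$$ For $\eta_x\in Q^0_x$, $X_x\in Q_x$ and a vector field $Y$ on $M$, put $\langle\eta_x,[X_x,Y]\rangle:=\langle\eta,[X,Y]\rangle(x)$ for any local sections $\eta$ of $Q^0$ and $X$ of $Q$ extending $\eta_x,X_x$ (independent of choices). A continuous piecewise smooth curve $c$ tangent to $Q$ is an abnormal extremal if there is a continuous piecewise smooth curve $\psi$ in $T^*M$ along $c$ (i.e. $\psi(t)\in T^*_{c(t)}M$), not meeting the zero section, with $\psi(t)\in Q^0$ for all $t$ and $\frac{d}{dt}\langle\psi(t),Y(c(t))\rangle=\langle\psi(t),[\dot c(t),Y]\rangle$ for all vector fields $Y$ on $M$ and all $t$ where $\dot c(t)$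 is defined. *)

(* Defs.v *)
(* MathComp-Analysis; the reals are an arbitrary [R : realType]. *)
From HB Require Import structures.
From mathcomp Require Import all_boot all_order all_algebra.
From mathcomp Require Import all_classical all_reals all_analysis.

Set Implicit Arguments.
Unset Strict Implicit.
Unset Printing Implicit Defensive.

Import Order.TTheory GRing.Theory Num.Theory.
Import numFieldNormedType.Exports.

Local Open Scope classical_set_scope.
Local Open Scope ring_scope.

Section Calculus.
Context {R : realType}.

(* Only used for open [U] and finite-dimensional [V], where continuity of all
   iterated directional derivatives is the usual notion of class C^k. *)
Fixpoint Ck (V W : normedModType R) (k : nat) (U : set V) (f : V -> W) : Prop :=
  if k is k'.+1 then
    (forall x, U x -> differentiable f x) /\ (forall v, Ck k' U ('D_v f))
  else forall x, U x -> {for x, continuous f}.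

Definition smooth_at (V W : normedModType R) (f : V -> W) (x : V) : Prop :=
  exists2 U : set V, open_nbhs x U & forall k, Ck k U f.

(* Derivative at [t] of the restriction of [f] to [A]: one-sided when [t] is an
   endpoint of an interval [A]. *)
Definition deriv_within (V : normedModType R) (A : set R) (f : R -> V)
    (t : R) (l : V) : Prop :=
  (s - t)^-1 *: (f s - f t) @[s --> within A t^'] --> l.

Definition linear_span (V : vectType R) (S : set V) : set V :=
  [set v | exists2 s : seq V, (forall w, w \in s -> S w) & v \in span s].

Definition piecewise (P : R -> R -> Prop) (a b : R) : Prop :=
  exists (m : nat) (tau : nat -> R), [/\ tau 0%N = a, tau m = b &
    forall i, (i < m)%N -> tau i < tau i.+1 /\ P (tau i) (tau i.+1)].

End Calculus.

(* The smooth structure is given by a smooth atlas, not assumed maximal.  The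
   total functions [chart i] and [chart_inv i] are meaningful only on
   [chart_dom i] and on its image under [chart i]. *)
Record manifold (R : realType) (n : nat) := Manifold {
  carrier :> topologicalType;
  manifold_hausdorff : hausdorff_space carrier;
  manifold_second_countable : @second_countable carrier;
  chart_index : Type;
  chart_dom : chart_index -> set carrier;
  chart : chart_index -> carrier -> 'rV[R]_n;
  chart_inv : chart_index -> 'rV[R]_n -> carrier;
  chart_at : carrier -> chart_index;
  dom_open : forall i, open (chart_dom i);
  image_open : forall i, open (chart i @` chart_dom i);
  chartK : forall i x, chart_dom i x -> chart_inv i (chart i x) = x;
  chart_continuous : forall i x, chart_dom i x -> {for x, continuous (chart i)};
  chart_inv_continuous : forall i x, chart_dom i x ->
    {for chart i x, continuous (chart_inv i)};
  chart_atP : forall x, chart_dom (chart_at x) x;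
  chart_compatible : forall i j x, chart_dom i x -> chart_dom j x ->
    smooth_at (chart j \o chart_inv i) (chart i x)
}.

Section Manifold.
Context {R : realType} {n : nat} {M : manifold R n}.

(* A tangent vector at [x] is encoded by its components in the preferred chart
   [chart_at x]; components in other charts are given by [chart_coord]. *)
Definition tspace (x : M) := 'rV[R]_n.

Definition cotspace (x : M) := 'Hom(tspace x, R^o).

Definition chart_coord (i : chart_index M) (x : M) (v : tspace x) : 'rV[R]_n :=
  'd (chart i \o chart_inv (chart_at x)) (chart (chart_at x) x) v.

(* The tangent vector at [x] with components [w] in chart [i]. *)
Definition of_chart_coord (i : chart_index M) (x : M) (w : 'rV[R]_n) :
    tspace x :=
  'd (chart (chart_at x) \o chart_inv i) (chart i x) w.

(* The components of a covector in the basis dual to the coordinate vectors of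
   chart [i]. *)
Definition cocoord (i : chart_index M) (x : M) (p : cotspace x) : 'rV[R]_n :=
  \row_j p (of_chart_coord i x (delta_mx 0 j)).

Definition tmap (f : M -> M) (x : M) (v : tspace x) : tspace (f x) :=
  'd (chart (chart_at (f x)) \o f \o chart_inv (chart_at x))
     (chart (chart_at x) x) v.

Definition vfield := forall x : M, tspace x.

Definition vfield_rep (X : vfield) (i : chart_index M) (y : 'rV[R]_n) :
    'rV[R]_n :=
  chart_coord i (X (chart_inv i y)).

(* A vector field on an open set [U] is a total one whose values outside [U]
   are ignored. *)
Definition smooth_vfield (U : set M) (X : vfield) : Prop :=
  forall x i, U x -> chart_dom i x -> smooth_at (vfield_rep X i) (chart i x).

(* [X, Y]^j = X^l d_l Y^j - Y^l d_l X^j in the chart [chart_at x]. *)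
Definition lie_bracket (X Y : vfield) (x : M) : tspace x :=
  let i := chart_at x in let p := chart i x in
  'd (vfield_rep Y i) p (vfield_rep X i p)
  - 'd (vfield_rep X i) p (vfield_rep Y i p).

Definition smooth_map_at (V : normedModType R) (g : V -> M) (w : V) : Prop :=
  {for w, continuous g} /\
  forall i, chart_dom i (g w) -> smooth_at (chart i \o g) w.

Definition curve (c : R -> M) (a b : R) : Prop :=
  exists (p q : R) (c' : R -> M), [/\ p < a, b < q,
    forall t, p < t < q -> smooth_map_at c' t &
    forall t, a <= t <= b -> c' t = c t].

(* [v] is the velocity at [t] of [c] restricted to [A]. *)
Definition velocity (A : set R) (c : R -> M) (t : R)
    (v : tspace (c t)) : Prop :=
  c @ within A (nbhs t) --> c t /\
  deriv_within A (chart (chart_at (c t)) \o c) t v.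

Arguments velocity : clear implicits.

(* Smoothness and continuity of the curve (c, psi) in the cotangent bundle, in
   the bundle charts induced by the charts of [M]. *)
Definition smooth_covector_at (c : R -> M) (psi : forall t, cotspace (c t))
    (t : R) : Prop :=
  smooth_map_at c t /\
  forall i, chart_dom i (c t) -> smooth_at (fun s => cocoord i (psi s)) t.

Definition continuous_covector (a b : R) (c : R -> M)
    (psi : forall t, cotspace (c t)) : Prop :=
  forall t, a <= t <= b ->
    c @ within `[a, b] (nbhs t) --> c t /\
    forall i, chart_dom i (c t) ->
      cocoord i (psi s) @[s --> within `[a, b] (nbhs t)] --> cocoord i (psi t).

Definition covector_curve (c : R -> M) (psi : forall t, cotspace (c t))
    (a b : R) : Prop :=
  exists (p q : R) (c' : R -> M) (psi' : forall t, cotspace (c' t)),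
  [/\ p < a, b < q,
    forall t, p < t < q -> smooth_covector_at psi' t &
    forall t, a <= t <= b -> c' t = c t /\ psi' t = psi t].

Definition tangent_distribution := forall x : M, {vspace tspace x}.

Definition regular_distribution (k : nat) (Q : tangent_distribution) : Prop :=
  forall x : M, exists (U : set M) (F : 'I_k -> vfield),
  [/\ open_nbhs x U, forall i, smooth_vfield U (F i) &
      forall y, U y -> basis_of (Q y) [tuple F i y | i < k]].

(* Through every point there is an integral manifold of [Q] (rank [k]), given
   by an injective immersive parametrization [g]. *)
Definition integrable_distribution (k : nat)
    (Q : tangent_distribution) : Prop :=
  forall x : M, exists (W : set 'rV[R]_k) (g : 'rV[R]_k -> M),
  [/\ open W, (exists2 w0, W w0 & g w0 = x),
      (forall u w, W u -> W w -> g u = g w -> u = w) &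
      forall w, W w ->
        let dg : 'rV[R]_k -> tspace (g w) :=
          'd (chart (chart_at (g w)) \o g) w in
        [/\ smooth_map_at g w, injective dg &
            forall v, v \in Q (g w) <-> exists u, v = dg u]].

Definition tangent_to (Q : tangent_distribution) (a b : R)
    (c : R -> M) : Prop :=
  forall t (v : tspace (c t)),
    a <= t <= b -> velocity `[a, b] c t v -> v \in Q (c t).

Definition immersed (a b : R) (c : R -> M) : Prop :=
  forall t (v : tspace (c t)), a <= t <= b -> velocity `[a, b] c t v -> v != 0.

Definition integral_curve (a b : R) (X : vfield) (c : R -> M) : Prop :=
  forall t, a <= t <= b -> velocity `[a, b] c t (X (c t)).

(* <eta_x, [v, Y]>: the common value of eta_x ([X, Y] x) for all local sections
   [X] of [Q] extending [v]; as <eta, [X, Y]> is evaluated pointwise in eta,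
   no extension of the covector enters. *)
Definition pairing (Q : tangent_distribution) (x : M) (eta : cotspace x)
    (v : tspace x) (Y : vfield) : R :=
  get [set r : R | exists (U : set M) (X : vfield),
    [/\ open_nbhs x U, smooth_vfield U X, forall y, U y -> X y \in Q y,
        X x = v & r = eta (lie_bracket X Y x)]].

Definition abnormal_extremal (Q : tangent_distribution) (a b : R)
    (c : R -> M) : Prop :=
  [/\ {within `[a, b], continuous c}, piecewise (curve c) a b,
      tangent_to Q a b c &
      exists psi : forall t, cotspace (c t),
      [/\ continuous_covector a b psi, piecewise (covector_curve psi) a b,
          forall t, a <= t <= b -> psi t != 0,
          forall t v, a <= t <= b -> v \in Q (c t) -> psi t v = 0 &
          forall Y, smooth_vfield setT Y ->
          forall t (v : tspace (c t)), a <= t <= b -> velocity `[a, b] c t v ->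
            deriv_within `[a, b] (fun s => psi s (Y (c s)) : R) t
              (pairing Q (psi t) v Y)]].

(* [phi] is the maximal local flow, with domain [D], of the vector field [X]
   on the open set [U]; [phi s x] is meaningful only for [(s, x)] in [D]. *)
Record local_flow (U : set M) (X : vfield) (D : set (R * M))
    (phi : R -> M -> M) : Prop := {
  flow_dom_open : open D;
  flow_dom_sub : forall s x, D (s, x) -> U x;
  flow_dom_interval : forall x, is_interval [set s | D (s, x)];
  flow_stays : forall s x, D (s, x) -> U (phi s x);
  flow0 : forall x, U x -> D (0, x) /\ phi 0 x = x;
  flow_velocity : forall s x, D (s, x) ->
    velocity [set r | D (r, x)] (phi^~ x) s (X (phi s x));
  flow_smooth : forall s x i, D (s, x) -> chart_dom i x ->
    smooth_map_at (fun z : R * 'rV[R]_n => phi z.1 (chart_inv i z.2))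
      (s, chart i x);
  flow_maximal : forall (J : set R) (g : R -> M), open J -> is_interval J ->
    J 0 -> (forall s, J s -> U (g s)) ->
    (forall s, J s -> velocity J g s (X (g s))) ->
    forall s, J s -> D (s, g 0) /\ phi s (g 0) = g s
}.

(* c^*_t Q.  For the flow of a field having [c] as an integral curve,
   phi (-s) (c (t + s)) = c t, so [tmap] lands in the tangent space at [c t]. *)
Definition pullback_space (Q : tangent_distribution) (phi : R -> M -> M)
    (a b : R) (c : R -> M) (t : R) : set (tspace (c t)) :=
  linear_span [set w | exists s (Y : tspace (c (t + s))),
    [/\ a - t <= s <= b - t, Y \in Q (c (t + s)) & w = tmap (phi (- s)) Y]].

End Manifold.

Arguments pullback_space {R n M} Q phi a b c t.
Arguments vfield {R n} M.
Arguments tangent_distribution {R n} M.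

(* Main.v *)
(* Let [A t] be the differential at [c a] of the flow [phi (t - a)].  Exchanging
   the time and space derivatives of the flow shows that in a chart
   [A' = DX * A], whereas testing the equation of an abnormal extremal on vector
   fields that are multiples of coordinate fields near a point of [c] turns it
   into the adjoint equation [psi' = - psi * DX].  Hence [psi] solves it if and
   only if [psi t \o A t] is constant, that is, [psi] is the transport by the
   flow of its value [psi a]; and the transported covectors annihilate [Q] all
   along [c] if and only if [psi a] annihilates the pullback space at [a].  A
   nonzero such [psi a] exists if and only if this space is proper. *)
Require Import Defs.
From HB Require Import structures.
From mathcomp Require Import all_boot all_order all_algebra.
From mathcomp Require Import all_classical all_reals all_analysis.
From mathcomp Require Import ring lra.

Import Order.TTheory GRing.Theory Num.Theory.
Import numFieldNormedType.Exports.

Local Open Scope classical_set_scope.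
Local Open Scope ring_scope.

Set Implicit Arguments.
Unset Strict Implicit.
Unset Printing Implicit Defensive.

(** * Differentials *)

(** The adjoint equation is never solved. From an extremal, constancy of [psi t \o A t] comes from
    the mean value theorem for derivatives within [[a, b]], one-sided at the endpoints. Conversely
    [psi] is defined by composing a covector at [c a] with the inverse of [A t], and its equation is
    read off by differentiating the constant pairing of [psi] with transported vectors; since [A t]
    is onto, this tests [psi'] on every vector.

    Three obstacles shape the file. Vectors are encoded in a preferred chart that may jump along
    [c], so every derivative is computed in one chart fixed around the time considered, and the
    pairing of covector and vector is shown to be the same number in all charts. The value of
    [pairing] is picked by [get], so its candidates must be shown equal: two sections of [Q]
    agreeing at a point have derivatives there that differ by an element of [Q], which is a
    closedness property of the spans of a frame. Finally the equation of an extremal is tested on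
    fields smooth on all of [M], so coordinate fields are cut off by bump functions and extended by
    zero, with the Hausdorff property making the support closed. *)

Section CoordinateFunctionals.
Context {R : realType} {n : nat}.

Fact coord_linear (j : 'I_n) : linear (fun v : 'rV[R]_n => v 0 j).
Proof. by move=> a u v; rewrite !mxE. Qed.

Definition coord_fun (j : 'I_n) : {linear 'rV[R]_n -> R} :=
  HB.pack (fun v : 'rV[R]_n => v 0 j)
    (GRing.isLinear.Build _ _ _ _ _ (coord_linear j)).

End CoordinateFunctionals.

Section Differential.
Context {R : realType}.
Implicit Types V W E F G : normedModType R.

(** Explicit estimates pass easily from one function to another with the same germ; this lemma and
    [diff_bound] translate between them and differentials. *)
Lemma diff_of_bound V W (f : V -> W) (L : {linear V -> W}) (x : V) :
  continuous L ->
  (forall e, 0 < e -> \forall h \near 0, `|f (h + x) - f x - L h| <= e * `|h|) ->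
  differentiable f x /\ 'd f x = L :> (V -> W).
Proof.
move=> Lc H.
have fE : f \o shift x = cst (f x) + L +o_ 0 id.
  apply/eqaddoP => e e0; near=> h.
  have -> : (f \o shift x - (cst (f x) + L)) h = f (h + x) - f x - L h.
    by rewrite !fctE /= opprD addrA.
  by near: h; exact: H.
have dE : 'd f x = L :> (V -> W) by exact: diff_unique.
split=> //; apply/diff_locallyP; rewrite dE; split => //.
Unshelve. all: by end_near. Qed.

Lemma diff_bound V W (f : V -> W) (x : V) : differentiable f x ->
  forall e, 0 < e ->
  \forall y \near x, `|f y - f x - 'd f x (y - x)| <= e * `|y - x|.
Proof.
move=> /diff_locally /eqaddoP H e /H{}H.
rewrite (near_shift 0 x); near=> h => /=.
rewrite !subr0.
have -> : f (h + x) - f x - 'd f x (h + x - x) =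
   (f \o shift x - (cst (f x) + 'd f x)) h.
  by rewrite !fctE /= addrK opprD addrA.
by rewrite addrK; near: h; exact: H.
Unshelve. all: by end_near. Qed.

(** Identities between charts, such as [chart_inv i] cancelling [chart i], hold only near a point.
    This lemma carries differentials across them. *)
Lemma near_eq_diff V W (f g : V -> W) (x : V) :
  (\near x, f x = g x) -> differentiable f x ->
  differentiable g x /\ 'd g x = 'd f x :> (V -> W).
Proof.
move=> fg df; apply: diff_of_bound; first exact: diff_continuous.
move=> e e0.
have := diff_bound df e0; rewrite (near_shift 0 x) => H.
have := fg; rewrite (near_shift 0 x) => fg'.
near=> h.
rewrite -(nbhs_singleton fg).
have <- : f (h + x) = g (h + x).
  have : (f \o shift x) h = (g \o shift x) h by near: h; move: fg'; rewrite subr0.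
  by [].
near: h; move: H; rewrite subr0; apply: filterS => h /=.
by rewrite !addrK.
Unshelve. all: by end_near. Qed.

End Differential.

(** * Functions of class C^k *)

Section Scale.
Context {R : realType} {V : normedModType R}.

(** Declaring scaling bilinear lets [diff_bilin] give the Leibniz rule [diff_scale]. *)
Lemma scale_is_bilinear :
  bilinear_for
    (GRing.Scale.Law.clone _ _ *:%R _) (GRing.Scale.Law.clone _ _ *:%R _)
    (@GRing.scale R V : R -> V -> V).
Proof.
split=> [u'|u] a x y /=; first by rewrite scalerDl scalerA.
by rewrite scalerDr !scalerA mulrC.
Qed.

HB.instance Definition _ := bilinear_isBilinear.Build R R V V _ _
  (@GRing.scale R V : R -> V -> V) scale_is_bilinear.

Lemma diff_scale (E : normedModType R) (a : E -> R) (f : E -> V) x :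
  differentiable a x -> differentiable f x ->
  differentiable (fun y => a y *: f y) x /\
  'd (fun y => a y *: f y) x =
    (fun v => a x *: 'd f x v + 'd a x v *: f x) :> (E -> V).
Proof.
move=> da df.
have -> : (fun y => a y *: f y) =
    (fun p : R * V => p.1 *: p.2) \o (fun y => (a y, f y)) by [].
have sc : continuous (fun p : R * V => p.1 *: p.2) by exact: scale_continuous.
have ds p : differentiable (fun p : R * V => p.1 *: p.2) p.
  exact: (differentiable_bilin (f := @GRing.scale R V)).
split; first by apply: differentiable_comp => //; exact: differentiable_pair.
rewrite diff_comp//; last exact: differentiable_pair.
rewrite diff_pair//= (diff_bilin (f := @GRing.scale R V))//.
Qed.

End Scale.

Section CkTheory.
Context {R : realType}.
Implicit Types V W E F G : normedModType R.

Lemma Ck_subset V W k (U U' : set V) (f : V -> W) :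
  U' `<=` U -> Ck k U f -> Ck k U' f.
Proof.
elim: k f => [|k IH] f UU /=; first by move=> H x /UU; exact: H.
by case=> H1 H2; split=> [x /UU|v]; [exact: H1|exact: IH].
Qed.

Lemma CkW V W k (U : set V) (f : V -> W) : Ck k.+1 U f -> Ck k U f.
Proof.
elim: k f => [|k IH] f.
  by case=> H _ x Ux; apply: differentiable_continuous; exact: H.
by case=> H1 H2; split=> // v; apply: IH; exact: H2.
Qed.

Lemma Ck_eq V W k (U : set V) (f g : V -> W) : open U ->
  (forall x, U x -> f x = g x) -> Ck k U f -> Ck k U g.
Proof.
move=> oU.
have nearU x : U x -> forall f g : V -> W, (forall x, U x -> f x = g x) ->
    \near x, f x = g x.
  move=> Ux f' g' H; near=> y; apply: H; near: y; exact: open_nbhs_nbhs.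
elim: k f g => [|k IH] f g fg /=.
  move=> H x Ux; rewrite /prop_for /continuous_at -fg//.
  have fgx : \forall y \near x, f y = g y by exact: nearU.
  by apply: cvg_trans (H _ Ux); apply: near_eq_cvg.
case=> H1 H2; split=> [x Ux|v].
  by have [] := near_eq_diff (nearU _ Ux _ _ fg) (H1 _ Ux).
apply: IH (H2 v) => x Ux; apply: near_eq_derive.
exact: nearU.
Unshelve. all: by end_near. Qed.

Lemma Ck_cst V W k (U : set V) (w : W) : Ck k U (cst w).
Proof.
elim: k w => [|k IH] w /=; first by move=> x _; exact: cst_continuous.
split=> // v; rewrite (_ : 'D_v _ = cst 0) ?funeqE//= => x.
exact: derive_cst.
Qed.

Lemma CkD V W k (U : set V) (f g : V -> W) : open U ->
  Ck k U f -> Ck k U g -> Ck k U (f + g).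
Proof.
move=> oU; elim: k f g => [|k IH] f g /=.
  by move=> H1 H2 x Ux; apply: cvgD; [exact: H1|exact: H2].
move=> [df Hf] [dg Hg]; split=> [x Ux|v].
  by apply: differentiableD; [exact: df|exact: dg].
apply: Ck_eq (IH _ _ (Hf v) (Hg v)) => // x Ux.
rewrite fctE deriveD//; apply: diff_derivable; [exact: df|exact: dg].
Qed.

Lemma Ck_sum V W k (U : set V) m (f : 'I_m -> V -> W) : open U ->
  (forall i, Ck k U (f i)) -> Ck k U (\sum_i f i).
Proof.
move=> oU H; elim/big_ind : _ => //; [exact: Ck_cst|].
by move=> f' g'; exact: CkD.
Qed.

Lemma Ck_linear V W G k (U : set V) (L : {linear W -> G}) (f : V -> W) :
  open U -> continuous L -> Ck k U f -> Ck k U (L \o f).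
Proof.
move=> oU Lc; elim: k f => [|k IH] f /=.
  by move=> H x Ux; apply: continuous_comp; [exact: H|exact: Lc].
have dL y : differentiable L y by exact: linear_differentiable.
move=> [df Hf]; split=> [x Ux|v].
  by apply: differentiable_comp => //; exact: df.
apply: Ck_eq (IH _ (Hf v)) => // x Ux.
have dfx := df _ Ux.
rewrite /= (deriveE v dfx) (@deriveE _ _ _ (L \o f))//; last exact: differentiable_comp.
by rewrite (@diff_comp _ _ _ _ f L)//= (@diff_lin _ _ _ L).
Qed.

Lemma Ck_linear_id V W k (U : set V) (L : {linear V -> W}) :
  open U -> continuous L -> Ck k U L.
Proof.
move=> oU Lc; case: k => [|k] /=; first by move=> x _; exact: Lc.
have dL y : differentiable L y by exact: linear_differentiable.
split=> // v; apply: (@Ck_eq _ _ _ _ (cst (L v))) => //.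
  by move=> x _; rewrite deriveE// diff_lin.
exact: Ck_cst.
Qed.

Lemma Ck_scale V W k (U : set V) (a : V -> R) (f : V -> W) : open U ->
  Ck k U a -> Ck k U f -> Ck k U (fun x => a x *: f x).
Proof.
move=> oU; elim: k a f => [|k IH] a f.
  by move=> H1 H2 x Ux; apply: cvgZ; [exact: H1|exact: H2].
move=> Ha Hf; have [da Da] := Ha; have [df Df] := Hf; split=> [x Ux|v].
  by have [] := diff_scale (da _ Ux) (df _ Ux).
apply: (@Ck_eq _ _ _ _ ((fun x => a x *: 'D_v f x) + (fun x => 'D_v a x *: f x))) => //.
  move=> x Ux; have [ds sE] := diff_scale (da _ Ux) (df _ Ux).
  by rewrite fctE /= (deriveE v ds) sE /= (deriveE v (df _ Ux)) (deriveE v (da _ Ux)).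
apply: CkD => //; apply: IH; [exact: CkW|exact: Df|exact: Da|exact: CkW].
Qed.

(** [Ck] differentiates along fixed vectors, whereas the chain rule for [g \o f] differentiates [g]
    along the moving vector ['D_v f x]. Finitely many continuous coordinates on the middle space
    resolve it into fixed directions. *)
Definition finite_coords W := exists (m : nat) (e : 'I_m -> W)
  (l : 'I_m -> {linear W -> R}),
  (forall i, continuous (l i)) /\ forall w, w = \sum_i l i w *: e i.

Lemma finite_coords_R : finite_coords R.
Proof.
exists 1%N, (fun=> 1), (fun=> idfun); split=> [_ x//|w].
by rewrite big_ord_recl big_ord0 addr0 /= [_ *: _]mulr1.
Qed.

Lemma finite_coords_rV n : finite_coords 'rV[R]_n.
Proof.
exists n, (fun i => delta_mx 0 i), (@coord_fun R n).
split=> [i|w]; first exact: coord_continuous.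
exact: row_sum_delta.
Qed.

Lemma finite_coords_prod V W :
  finite_coords V -> finite_coords W -> finite_coords (V * W)%type.
Proof.
move=> [m [e [l [lc lE]]]] [p [e' [l' [lc' lE']]]].
exists (m + p)%N,
  (fun i : 'I_(m + p) =>
     match fintype.split i with inl i => (e i, 0) | inr j => (0, e' j) end),
  (fun i : 'I_(m + p) => match fintype.split i return {linear (V * W)%type -> R} with
            | inl i => (l i \o fst : {linear (V * W)%type -> R})
            | inr j => (l' j \o snd : {linear (V * W)%type -> R}) end).
split.
  move=> i; case: (fintype.split i) => j x.
    by apply: (@continuous_comp _ _ _ fst (l j)); [exact: cvg_fst|exact: lc].
  by apply: (@continuous_comp _ _ _ snd (l' j)); [exact: cvg_snd|exact: lc'].
move=> [v w]; rewrite big_split_ord /=.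
under eq_bigr => i _ do rewrite (unsplitK (inl i)) /=.
under [X in _ = _ + X]eq_bigr => i _ do rewrite (unsplitK (inr i)) /=.
rewrite {1}(lE v) {1}(lE' w).
have -> : (\sum_i l i v *: e i, \sum_i l' i w *: e' i) =
  (\sum_i l i v *: e i, 0) + (0, \sum_i l' i w *: e' i).
  by congr (_, _); rewrite ?addr0 ?add0r.
congr (_ + _); apply: injective_projections => /=.
- by rewrite (raddf_sum (fst : {linear (V * W)%type -> V})).
- rewrite (raddf_sum (snd : {linear (V * W)%type -> W})) big1//= => i _; by rewrite scaler0.
- rewrite (raddf_sum (fst : {linear (V * W)%type -> V})) big1//= => i _; by rewrite scaler0.
- by rewrite (raddf_sum (snd : {linear (V * W)%type -> W})).
Qed.

(** Induction on [k]: ['D_v (g \o f)] is the sum over [i] of the coordinate [l i] of ['D_v f] times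
    ['D_(e i) g \o f], and the induction hypothesis applies to the second factor. *)
Lemma Ck_comp V W G k (U : set V) (U' : set W) (f : V -> W) (g : W -> G) :
  finite_coords W -> open U -> open U' -> (forall x, U x -> U' (f x)) ->
  Ck k U f -> Ck k U' g -> Ck k U (g \o f).
Proof.
move=> [m [e [l [lc lE]]]] oU oU' UU.
elim: k f g UU => [|k IH] f g UU.
  by move=> Hf Hg x Ux; apply: continuous_comp; [exact: Hf|apply: Hg; exact: UU].
move=> Hf Hg; have [df Df] := Hf; have [dg Dg] := Hg.
split=> [x Ux|v].
  by apply: differentiable_comp; [exact: df|apply: dg; exact: UU].
apply: (@Ck_eq _ _ _ _
  (\sum_i (fun x => (l i \o 'D_v f) x *: ('D_(e i) g \o f) x))) => //.
  move=> x Ux; have dfx := df _ Ux; have dgx := dg _ (UU _ Ux).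
  rewrite fct_sumE /= [RHS]deriveE; last exact: differentiable_comp.
  rewrite (@diff_comp _ _ _ _ f g)//= -(deriveE v dfx) [X in _ = 'd g _ X]lE.
  rewrite linear_sum /=; apply: eq_bigr => i _.
  by rewrite linearZ /= (deriveE _ dgx).
apply: Ck_sum => // i; apply: Ck_scale => //; first by apply: Ck_linear => //; exact: Df.
by apply: IH => //; [exact: CkW|exact: Dg].
Qed.

Lemma open_preimage_continuous V W (U : set V) (U' : set W) (f : V -> W) :
  open U -> open U' -> (forall x, U x -> {for x, continuous f}) ->
  open (U `&` f @^-1` U').
Proof.
move=> oU oU' fc; rewrite openE => x [Ux fx]; apply: filterI.
  exact: open_nbhs_nbhs.
by apply: (fc _ Ux); exact: open_nbhs_nbhs.
Qed.

Lemma smooth_at_comp V W G (f : V -> W) (g : W -> G) x : finite_coords W ->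
  smooth_at f x -> smooth_at g (f x) -> smooth_at (g \o f) x.
Proof.
move=> Wf [U [oU Ux] Cf] [U' [oU' Ux'] Cg].
have oI := open_preimage_continuous oU oU' (Cf 0%N).
exists (U `&` f @^-1` U'); first by split.
move=> k; apply: (Ck_comp Wf oI oU' _ _ (Cg k)) ; first by move=> y [].
by apply: Ck_subset (Cf k) => y [].
Qed.

Lemma smooth_at_near V W (f g : V -> W) x :
  (\near x, f x = g x) -> smooth_at f x -> smooth_at g x.
Proof.
rewrite -nbhs_nearE nbhsE /=; case=> O [oO Ox] fg [U [oU Ux] Cf].
have oUO := openI oU oO.
exists (U `&` O) => [//|k].
apply: (@Ck_eq _ _ _ _ f) => //; first by move=> y [_]; exact: fg.
by apply: Ck_subset (Cf k) => y [].
Qed.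

Lemma smooth_at_binop V W W' G (op : (V -> W) -> (V -> W') -> V -> G)
  (f : V -> W) (g : V -> W') x :
  (forall k (U : set V), open U -> Ck k U f -> Ck k U g -> Ck k U (op f g)) ->
  smooth_at f x -> smooth_at g x -> smooth_at (op f g) x.
Proof.
move=> H [U [oU Ux] Cf] [U' [oU' Ux'] Cg].
exists (U `&` U'); first by split => //; exact: openI.
move=> k; apply: H; first exact: openI.
  by apply: Ck_subset (Cf k) => ? [].
by apply: Ck_subset (Cg k) => ? [].
Qed.

Lemma smooth_atD V W (f g : V -> W) x :
  smooth_at f x -> smooth_at g x -> smooth_at (f + g) x.
Proof. by apply: (smooth_at_binop (op := +%R)) => k U oU; exact: CkD. Qed.

Lemma smooth_at_scale V W (a : V -> R) (f : V -> W) x :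
  smooth_at a x -> smooth_at f x -> smooth_at (fun x => a x *: f x) x.
Proof.
apply: (@smooth_at_binop V R W W (fun a (f : V -> W) x => a x *: f x)).
by move=> k U oU; exact: Ck_scale.
Qed.

Lemma smooth_at_cst V W (w : W) (x : V) : smooth_at (cst w) x.
Proof. by exists setT => [|k]; [split => //; exact: openT|exact: Ck_cst]. Qed.

Lemma smooth_at_sum V W m (f : 'I_m -> V -> W) x :
  (forall i, smooth_at (f i) x) -> smooth_at (\sum_i f i) x.
Proof.
move=> H; elim/big_ind : _ => //; first exact: smooth_at_cst.
by move=> f' g'; exact: smooth_atD.
Qed.

Lemma smooth_at_linear V W (L : {linear V -> W}) x :
  continuous L -> smooth_at L x.
Proof.
move=> Lc; exists setT => [|k]; first by split => //; exact: openT.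
by apply: Ck_linear_id => //; exact: openT.
Qed.

Lemma smooth_at_derive V W (f : V -> W) x v :
  smooth_at f x -> smooth_at ('D_v f) x.
Proof. by move=> [U Ux Cf]; exists U => // k; exact: (Cf k.+1).2. Qed.

Lemma smooth_at_diff V W (f : V -> W) x : smooth_at f x -> differentiable f x.
Proof. by move=> [U [_ Ux] Cf]; exact: (Cf 1%N).1. Qed.

Lemma smooth_at_continuous V W (f : V -> W) x :
  smooth_at f x -> {for x, continuous f}.
Proof. by move=> /smooth_at_diff; exact: differentiable_continuous. Qed.

(** The pair is the sum of [f] and [g] followed by the two linear injections into the product. *)
Lemma smooth_at_pair V W G (f : V -> W) (g : V -> G) x :
  finite_coords W -> finite_coords G ->
  smooth_at f x -> smooth_at g x -> smooth_at (fun y => (f y, g y)) x.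
Proof.
move=> Wf Gf sf sg.
have lin1 : linear (fun w : W => (w, 0 : G)).
  by move=> a u v; congr (_, _); rewrite /= scaler0 addr0.
have lin2 : linear (fun w : G => (0 : W, w)).
  by move=> a u v; congr (_, _); rewrite /= scaler0 addr0.
pose L1 : {linear W -> (W * G)%type} :=
  HB.pack (fun w : W => (w, 0 : G)) (GRing.isLinear.Build _ _ _ _ _ lin1).
pose L2 : {linear G -> (W * G)%type} :=
  HB.pack (fun w : G => (0 : W, w)) (GRing.isLinear.Build _ _ _ _ _ lin2).
have -> : (fun y => (f y, g y)) = (L1 \o f) + (L2 \o g).
  by apply/funext => y; rewrite fctE; congr (_, _); rewrite /= ?addr0 ?add0r.
apply: smooth_atD; apply: smooth_at_comp => //; apply: smooth_at_linear => y.
  by apply: cvg_pair => //=; exact: cvg_cst.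
by apply: cvg_pair => //=; exact: cvg_cst.
Qed.

End CkTheory.

(** * Symmetry of second derivatives *)

Section Schwarz.
Context {R : realType}.
Implicit Types V W : normedModType R.

Lemma is_derive_line V W (f : V -> W) (p u : V) (s : R) :
  differentiable f (p + s *: u) ->
  is_derive s 1 (fun s => f (p + s *: u)) ('D_u f (p + s *: u)).
Proof.
move=> df.
have dl : is_diff s (fun s : R => p + s *: u) (fun s => 0 + s *: u).
  exact: (is_diffD (is_diff_cst p s) (is_diff_scalel s u)).
have [dl1 dl2] := dl.
have dc : differentiable (f \o (fun s : R => p + s *: u)) s.
  by apply: differentiable_comp.
split; first exact: diff_derivable.
rewrite (@deriveE _ _ _ (f \o (fun s : R => p + s *: u)))// diff_comp//= dl2.
by rewrite add0r scale1r deriveE.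
Qed.

Lemma MVT_line V (f : V -> R) (p u : V) (h : R) : 0 < h ->
  (forall s, 0 <= s <= h -> differentiable f (p + s *: u)) ->
  exists2 s, 0 <= s <= h & f (p + h *: u) - f p = h * 'D_u f (p + s *: u).
Proof.
move=> h0 df.
have [||s sh E] := @MVT R (fun s => f (p + s *: u))
  (fun s => 'D_u f (p + s *: u)) 0 h h0.
- by move=> s /itvP sh; apply/is_derive_line/df; rewrite !sh.
- apply: derivable_within_continuous => s /itvP sh.
  by have [] := is_derive_line (df s _) ; rewrite ?sh.
- exists s; first by rewrite !(itvP sh).
  by rewrite /= scale0r addr0 subr0 mulrC in E.
Qed.

(** The mean value theorem is used twice: along [u] for the increment of [f] by [h *: v], then along
    [v] for ['D_u f]. *)
Lemma mixed_difference V (U : set V) (f : V -> R) (x u v : V) (h : R) :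
  Ck 2 U f -> 0 < h ->
  (forall s t, 0 <= s <= h -> 0 <= t <= h -> U (x + s *: u + t *: v)) ->
  exists s t, [/\ 0 <= s <= h, 0 <= t <= h &
    f (x + h *: u + h *: v) - f (x + h *: u) - f (x + h *: v) + f x =
    h ^+ 2 * 'D_v ('D_u f) (x + s *: u + t *: v)].
Proof.
move=> [df Df] h0 UU; have [du Du] := Df u.
have hh : 0 <= h <= h by rewrite lexx (ltW h0).
have h00 : 0 <= (0 : R) <= h by rewrite lexx (ltW h0).
have [|s sh Es] := @MVT_line _ (fun y => f (y + h *: v) - f y) x u h h0.
  move=> s sh; apply: differentiableB.
    apply: (@differentiable_comp _ _ _ _ (fun y => y + h *: v) f) => //.
    by apply: df; apply: UU.
  by apply: df; rewrite -[X in U X]addr0 -(scale0r v); apply: UU.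
- have dfs : differentiable f (x + s *: u).
    by apply: df; rewrite -[X in U X]addr0 -(scale0r v); apply: UU.
  have dfs' : differentiable f (x + s *: u + h *: v) by apply: df; apply: UU.
  have Dg : 'D_u (fun y => f (y + h *: v) - f y) (x + s *: u) =
      'D_u f (x + s *: u + h *: v) - 'D_u f (x + s *: u).
    have dsh : is_diff (x + s *: u) (fun y : V => y + h *: v) (fun y => y + 0).
      exact: (is_diffD (is_diff_id _) (is_diff_cst (h *: v) _)).
    have [dsh1 dsh2] := dsh.
    have dfc : differentiable (f \o (fun y => y + h *: v)) (x + s *: u).
      by apply: differentiable_comp.
    rewrite (@deriveB _ _ _ (f \o (fun y => y + h *: v)) f); last 2 first.
    - exact: diff_derivable.
    - exact: diff_derivable.
    congr (_ - _).
    by rewrite (deriveE _ dfc) (deriveE _ dfs') diff_comp//= dsh2 addr0.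
  have [|t th Et] := @MVT_line _ ('D_u f) (x + s *: u) v h h0.
    by move=> t th; apply: du; apply: UU.
  exists s, t; split => //.
  rewrite expr2 -mulrA -Et -Dg -Es; ring.
Qed.

Lemma dist_common_le (a b c e : R) :
  `|a - c| < e / 2 -> `|b - c| < e / 2 -> `|b - a| <= e.
Proof.
move=> H1 H2; rewrite (_ : b - a = (b - c) - (a - c)); last by ring.
by rewrite (splitr e); apply: le_trans (ler_normB _ _) _; apply: lerD; exact: ltW.
Qed.

Lemma near_box V (x u v : V) (N : set V) : nbhs x N ->
  exists2 h : R, 0 < h & forall s t, 0 <= s <= h -> 0 <= t <= h ->
    N (x + s *: u + t *: v).
Proof.
move=> /nbhs_ballP[e /= e0 He].
(* The summand 1 keeps the denominator positive when [u] and [v] both vanish. *)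
have d0 : 0 < `|u| + `|v| + 1 by rewrite ltr_wpDl// addr_ge0.
exists (e / (`|u| + `|v| + 1)); first by rewrite divr_gt0.
move=> s t /andP[s0 sh] /andP[t0 th]; apply: He.
rewrite -ball_normE /ball_ /= -addrA opprD addrA subrr sub0r normrN.
apply: (le_lt_trans (ler_normD _ _)); rewrite !normrZ !ger0_norm//.
apply: (@le_lt_trans _ _ (e / (`|u| + `|v| + 1) * (`|u| + `|v|))).
  by rewrite mulrDr lerD// ler_wpM2r.
rewrite mulrAC ltr_pdivrMr// ltr_pM2l// ltrDl//.
Qed.

(** The second difference of [f] is symmetric in [u] and [v]. By [mixed_difference] the two mixed
    derivatives therefore take a common value at two points of an arbitrarily small box at [x], and
    continuity brings the comparison to [x]. *)
Lemma derive_commR V (U : set V) (f : V -> R) (x u v : V) :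
  open U -> U x -> Ck 2 U f -> 'D_u ('D_v f) x = 'D_v ('D_u f) x.
Proof.
move=> oU Ux Cf; apply/eqP; rewrite -subr_eq0 -normr_le0.
apply/ler_addgt0Pl => e e0; rewrite addr0.
have e2 : 0 < e / 2 by rewrite divr_gt0.
have cuv : {for x, continuous ('D_u ('D_v f))} by exact: ((Cf.2 v).2 u x Ux).
have cvu : {for x, continuous ('D_v ('D_u f))} by exact: ((Cf.2 u).2 v x Ux).
have /cvgrPdist_lt/(_ _ e2) N1 := cuv.
have /cvgrPdist_lt/(_ _ e2) N2 := cvu.
have NU : nbhs x U by exact: open_nbhs_nbhs.
have [h h0 Hh] := near_box u v (filterI (filterI N1 N2) NU).
have [|s [t [sh th E1]]] := @mixed_difference _ U f x u v h Cf h0.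
  by move=> s t sh th; have [] := Hh _ _ sh th.
have [|s' [t' [sh' th' E2]]] := @mixed_difference _ U f x v u h Cf h0.
  by move=> s' t' sh' th'; rewrite addrAC; have [] := Hh _ _ th' sh'.
have [[_ H1] _] := Hh _ _ sh th.
have [[H2 _] _] := Hh _ _ th' sh'.
have : 'D_v ('D_u f) (x + s *: u + t *: v) =
       'D_u ('D_v f) (x + t' *: u + s' *: v).
  have h20 : h ^+ 2 != 0 by rewrite expf_neq0// gt_eqF.
  apply: (mulfI h20); rewrite -E1 (addrAC x (t' *: u)) -E2.
  rewrite (addrAC x (h *: v)); ring.
move=> E; rewrite /= in H1 H2; rewrite E in H1.
exact: dist_common_le H1 H2.
Qed.

Lemma derive_comm V n (U : set V) (f : V -> 'rV[R]_n) (x u v : V) :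
  open U -> U x -> Ck 2 U f -> 'D_u ('D_v f) x = 'D_v ('D_u f) x.
Proof.
move=> oU Ux Cf; apply/rowP => j.
pose L := @coord_fun R n j.
have Lc : continuous L by exact: coord_continuous.
have dL y : differentiable L y by exact: linear_differentiable.
have DL (g : V -> 'rV[R]_n) w y : differentiable g y ->
    'D_w (L \o g : V -> R) y = L ('D_w g y).
  move=> dg; rewrite (deriveE _ dg) (@deriveE _ _ _ (L \o g)).
    by rewrite (@diff_comp _ _ _ _ g L)//= (@diff_lin _ _ _ L).
  exact: differentiable_comp.
have Cd w : Ck 1 U ('D_w f) by case: Cf => _ /(_ w).
have eqL w z : 'D_w ('D_z f) x 0 j = 'D_w ('D_z (L \o f : V -> R)) x.
  transitivity ('D_w (L \o 'D_z f : V -> R) x).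
    by rewrite (DL ('D_z f))//; case: (Cd z) => + _; apply.
  apply: near_eq_derive; near=> y; rewrite (DL f)//; case: Cf => + _; apply.
  by near: y; exact: open_nbhs_nbhs.
apply: (etrans (eqL u v) (etrans _ (esym (eqL v u)))).
apply: (@derive_commR V U (L \o f : V -> R) x u v oU Ux).
exact: Ck_linear.
Unshelve. all: by end_near. Qed.

End Schwarz.

(** * Derivatives within a subset of the line *)

Section DerivWithin.
Context {R : realType}.
Implicit Types V W : normedModType R.

Lemma deriv_within_cvg V (A : set R) (f : R -> V) t l :
  deriv_within A f t l -> f s @[s --> within A t^'] --> f t.
Proof.
move=> df.
have st : (fun s : R => s - t) @ within A t^' --> (0 : R).
  rewrite -(subrr t); apply: cvgB; last exact: cvg_cst.
  by apply: cvg_within_filter; exact: nbhs_dnbhs.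
have H : f t + (s - t) *: ((s - t)^-1 *: (f s - f t)) @[s --> within A t^'] --> f t.
  rewrite -[X in _ --> X]addr0 -(scale0r l).
  by apply: cvgD; [exact: cvg_cst|exact: cvgZ].
move: H; apply: cvg_trans; apply: near_eq_cvg.
rewrite near_withinE; near=> s => _.
rewrite /= addrC scalerA divff; first by rewrite scale1r subrK.
rewrite subr_eq0.
by near: s; exact: nbhs_dnbhs_neq.
Unshelve. all: by end_near. Qed.

Lemma deriv_within_eq V (A B : set R) (f g : R -> V) t l :
  (\forall s \near t, B s -> A s /\ f s = g s) -> f t = g t ->
  deriv_within A f t l -> deriv_within B g t l.
Proof.
move=> H ft df.
have BA : within B t^' `=>` within A t^'.
  move=> P; rewrite /within /=; move: (nbhs_dnbhs H) => H'.
  move=> HP; near=> s => Bs.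
  have As : A s by have [] := (near H' s _) Bs.
  by apply: (near HP s).
apply: cvg_trans (cvg_trans (cvg_app _ BA) df).
apply: near_eq_cvg; rewrite near_withinE.
apply: nbhs_dnbhs; apply: filterS H => s H /H [_ E].
by rewrite E ft.
Unshelve. all: by end_near. Qed.

Lemma deriv_within_unique V (A : set R) (f : R -> V) t l l' :
  ProperFilter (within A t^') ->
  deriv_within A f t l -> deriv_within A f t l' -> l = l'.
Proof. by move=> PF; apply: cvg_unique. Qed.

(** Makes derivatives within [[a, b]] unique, endpoints included. The point [t] is moved by [d], at
    most half the length, towards the farther endpoint. *)
Lemma within_dnbhs_itv_proper (a b t : R) : a < b -> a <= t <= b ->
  ProperFilter (within `[a, b] t^').
Proof.
move=> ab /andP[at_ tb]; apply: Build_ProperFilter_ex => P [e /= e0 He].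
pose d := Num.min (e / 2) ((b - a) / 2).
have d0 : 0 < d by rewrite lt_min !divr_gt0// subr_gt0.
have de : d < e by rewrite gt_min; apply/orP; left; lra.
have dba : d <= (b - a) / 2 by rewrite ge_min lexx orbT.
have [tm|tm] := leP t ((a + b) / 2).
  exists (t + d); apply: (He (t + d)) => /=.
  - by rewrite /ball_ opprD addrA subrr sub0r normrN gtr0_norm.
  - by rewrite -subr_eq0 addrAC subrr add0r gt_eqF.
  - by rewrite in_itv /=; apply/andP; split; lra.
exists (t - d); apply: (He (t - d)) => /=.
- by rewrite /ball_ opprB addrCA subrr addr0 gtr0_norm.
- by rewrite -subr_eq0 addrAC subrr add0r oppr_eq0 gt_eqF.
- by rewrite in_itv /=; apply/andP; split; lra.
Qed.

Lemma deriv_within_nbhs V (A : set R) (f : R -> V) (t : R) (l : V) : nbhs t A ->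
  deriv_within A f t l -> is_derive t (1 : R) f l.
Proof.
move=> At /(@deriv_within_eq _ _ setT f f t) df.
have {df} df : deriv_within setT f t l.
  by apply: df => //; apply: filterS At.
have H : (fun h : R => h^-1 *: ((f \o shift t) (h *: 1) - f t)) @ 0^' --> l.
  move: df; rewrite /deriv_within withinET => /cvgrPdist_le H.
  apply/cvgrPdist_le => e e0; have [r /= r0 Hr] := H e e0.
  exists r => // h; rewrite /ball_ /= sub0r normrN => hr h0.
  have := Hr (h + t); rewrite /= addrK /shift /= [h%:A]mulr1; apply.
    by rewrite opprD addrCA subrr addr0 normrN.
  by rewrite -subr_eq0 addrK.
split; first by apply/cvg_ex; exists l.
exact: cvg_lim H.
Qed.

Lemma is_derive_deriv_within V (A : set R) (f : R -> V) (t : R) (l : V) :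
  is_derive t (1 : R) f l -> deriv_within A f t l.
Proof.
move=> [df <-].
suff : deriv_within setT f t ('D_1 f t).
  apply: (@deriv_within_eq _ setT A f f) => //.
  by apply: (@filterE _ (nbhs t)).
move: df => /cvgrPdist_le H.
rewrite /deriv_within withinET; apply/cvgrPdist_le => e e0.
have [r /= r0 Hr] := H e e0.
exists r => // s; rewrite /ball_ /= => sr st.
have := Hr (s - t); rewrite /= [(s - t)%:A]mulr1 subrK; apply.
  by rewrite sub0r normrN distrC.
by rewrite subr_eq0.
Qed.

Lemma deriv_within_comp V W (A : set R) (u : R -> V) (F : V -> W) t l :
  deriv_within A u t l -> differentiable F (u t) ->
  deriv_within A (F \o u) t ('d F (u t) l).
Proof.
move=> du dF.
have uc := deriv_within_cvg du.
have dFl : 'd F (u t) ((s - t)^-1 *: (u s - u t)) @[s --> within A t^'] -->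
    'd F (u t) l.
  by apply: continuous_cvg => //; exact: diff_continuous.
apply/cvgrPdist_le => e e0.
have e2 : 0 < e / 2 by rewrite divr_gt0.
have C0 : 0 < `|l| + 1 by rewrite ltr_wpDl.
(* Near [t] the difference quotient [q] of [u] is bounded by [|l| + 1], so with this constant the
   remainder of [F] contributes at most [e / 2]. *)
have e3 : 0 < e / 2 / (`|l| + 1) by rewrite divr_gt0.
have H1 := (cvgrPdist_le _ _).1 dFl _ e2.
have H2 := uc _ (diff_bound dF e3).
have H3 := (cvgrPdist_le _ _).1 du 1 ltr01.
have nt : \forall s \near within A t^', s != t.
  by rewrite near_withinE; near=> s => _; near: s; exact: nbhs_dnbhs_neq.
near=> s.
have st : s != t by near: s; exact: nt.
set q := (s - t)^-1 *: (u s - u t).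
have uq : u s - u t = (s - t) *: q.
  by rewrite scalerA divff ?scale1r// subr_eq0.
have ql : `|l - q| <= 1 by rewrite /q; near: s; exact: H3.
have qC : `|q| <= `|l| + 1.
  by rewrite -[q](subKr l) (le_trans (ler_normB _ _))// lerD2l.
have bd : `|F (u s) - F (u t) - 'd F (u t) (u s - u t)| <=
    e / 2 / (`|l| + 1) * `|u s - u t| by near: s; exact: H2.
have lq : `|'d F (u t) l - 'd F (u t) q| <= e / 2 by rewrite /q; near: s; exact: H1.
rewrite /= (splitr e).
rewrite (_ : _ - _ = ('d F (u t) l - 'd F (u t) q) -
   (s - t)^-1 *: (F (u s) - F (u t) - 'd F (u t) (u s - u t))).
  apply: (le_trans (ler_normB _ _)); apply: lerD => //.
  rewrite normrZ normfV ler_pdivrMl ?normr_gt0 ?subr_eq0//.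
  apply: (le_trans bd); rewrite uq normrZ mulrCA ler_wpM2l//.
  by rewrite mulrAC ler_pdivrMr// ler_wpM2l// ltW.
have Eq : (s - t)^-1 *: 'd F (u t) (u s - u t) = 'd F (u t) q by rewrite -linearZ.
by rewrite (scalerBr _ (F (u s) - F (u t))) Eq opprB addrA subrK.
Unshelve. all: by end_near. Qed.

Lemma deriv_withinD V (A : set R) (f g : R -> V) t l m :
  deriv_within A f t l -> deriv_within A g t m ->
  deriv_within A (f + g) t (l + m).
Proof.
move=> df dg; rewrite /deriv_within.
have -> : (fun s => (s - t)^-1 *: ((f + g) s - (f + g) t)) =
    (fun s => (s - t)^-1 *: (f s - f t)) + (fun s => (s - t)^-1 *: (g s - g t)).
  by apply/funext => s; rewrite !fctE -scalerDr opprD addrACA.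
exact: cvgD.
Qed.

Lemma deriv_within_scale V (A : set R) (a : R -> R) (f : R -> V) t l m :
  deriv_within A a t l -> deriv_within A f t m ->
  deriv_within A (fun s => a s *: f s) t (l *: f t + a t *: m).
Proof.
move=> da df; have fc := deriv_within_cvg df; rewrite /deriv_within.
have -> : (fun s => (s - t)^-1 *: (a s *: f s - a t *: f t)) =
    (fun s => ((s - t)^-1 * (a s - a t)) *: f s) +
    (fun s => a t *: ((s - t)^-1 *: (f s - f t))).
  apply/funext => s; rewrite !fctE /cst scalerA [a t * _]mulrC -!scalerA -scalerDr.
  by congr (_ *: _); rewrite scalerBl scalerBr addrA subrK.
by apply: cvgD; apply: cvgZ => //; exact: cvg_cst.
Qed.

Lemma deriv_within_cst V (A : set R) (w : V) t : deriv_within A (fun=> w) t 0.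
Proof. apply: is_derive_deriv_within. Qed.

Lemma deriv_within_sum V m (A : set R) (f : 'I_m -> R -> V) t (l : 'I_m -> V) :
  (forall i, deriv_within A (f i) t (l i)) ->
  deriv_within A (fun s => \sum_i f i s) t (\sum_i l i).
Proof.
move=> H; have -> : (fun s => \sum_i f i s) = \sum_i f i.
  by apply/funext => s; rewrite fct_sumE.
elim/big_ind2 : _ => //; first exact: deriv_within_cst.
by move=> g l1 h l2; exact: deriv_withinD.
Qed.

Lemma deriv_within_mx n (A : set R) (f : R -> 'rV[R]_n) t (l : 'rV[R]_n) :
  (forall j, deriv_within A (fun s => f s 0 j : R) t (l 0 j)) ->
  deriv_within A f t l.
Proof.
move=> H; apply/cvgrPdist_le => e e0.
have HH : \forall s \near within A t^', forall j,
   `|l 0 j - (s - t)^-1 *: (f s 0 j - f t 0 j)| <= e.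
  apply: filter_forall => j; exact: (cvgrPdist_le _ _).1 (H j) _ e0.
near=> s; rewrite /Num.Def.normr /= mx_normrE (bigmax_le _ (ltW e0))//= => -[i j] _.
rewrite ord1 !mxE /=.
by have := near HH s _; apply.
Unshelve. all: by end_near. Qed.

(** The mean value theorem on [[a, t]] asks for a derivative in the interior, where the one within
    [[a, b]] is two-sided, and only for continuity at the ends. *)
Lemma deriv_within_cst_itv (a b : R) (g : R -> R) : a < b ->
  (forall t, a <= t <= b -> deriv_within `[a, b] g t 0) ->
  forall t, a <= t <= b -> g t = g a.
Proof.
move=> ab dg t /andP[at_ tb].
have gc : {within `[a, t], continuous g}.
  apply/subspace_continuousP => s /= /itvP st.
  have /deriv_within_cvg gs : deriv_within `[a, b] g s 0.
    by apply: dg; rewrite !st /= (le_trans _ tb)// st.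
  move=> P Pg; have := gs P Pg; have /= Pgs := nbhs_singleton Pg.
  rewrite /= /within /= => -[e e0 He]; exists e => //= r re rt.
  have [->//|rs] := eqVneq r s.
  apply: (He r) => //=; move: rt; rewrite !in_itv /= => /andP[-> rt].
  exact: le_trans tb.
have [s _ E] : exists2 s, s \in `[a, t] & g t - g a = 0 * (t - a).
  have [|s sat E] := @MVT_segment _ g (fun=> 0) a t at_ _ gc; last by exists s.
  move=> s /itvP st; apply: (@deriv_within_nbhs _ `[a, b]).
    have := @near_in_itvoo _ a b s.
    rewrite in_itv /= !st /= (lt_le_trans _ tb) ?st// => /(_ isT).
    apply: filterS => r; rewrite /= !in_itv /= => /andP[ar rb].
    by rewrite (ltW ar) (ltW rb).
  by apply: dg; rewrite !st /= (le_trans _ tb)// st.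
by apply/eqP; rewrite -subr_eq0 E mul0r.
Qed.

End DerivWithin.

(** * Bump functions *)

Section Bump.
Context {R : realType}.

(* The factors [x^-1 ^+ m] make this family stable under derivation, up to
   linear combinations. *)
Definition flat_fun (m : nat) (x : R) : R :=
  if 0 < x then x^-1 ^+ m * expR (- x^-1) else 0.

(** The exponential dominates the term of degree [m.+1] of its series, taken at [x^-1]. The
    resulting linear decay at 0, valid for every [m], is what differentiability at 0 requires. *)
Lemma flat_fun_le m x : `|flat_fun m x| <= (m.+1)`!%:R * `|x|.
Proof.
rewrite /flat_fun; case: ifPn => [x0|_]; last by rewrite normr0 mulr_ge0.
have y0 : 0 < x^-1 by rewrite invr_gt0.
rewrite ger0_norm ?mulr_ge0 ?exprn_ge0 ?expR_ge0 ?(ltW y0)// gtr0_norm//.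
have f0 : 0 < (m.+1)`!%:R :> R by rewrite ltr0n fact_gt0.
have := expR_ge1Dxn m (ltW y0); rewrite -lerBrDl => H.
have {}H : x^-1 ^+ m.+1 / (m.+1)`!%:R <= expR x^-1.
  by apply: (le_trans H); rewrite gerBl.
rewrite expRN ler_pdivrMr ?expR_gt0//.
have -> : x^-1 ^+ m = (m.+1)`!%:R * x * (x^-1 ^+ m.+1 / (m.+1)`!%:R).
  have xn0 : x != 0 by rewrite gt_eqF.
  have fn0 : (m.+1)`!%:R != 0 :> R by rewrite gt_eqF.
  rewrite exprS; move: (x^-1 ^+ m) ((m.+1)`!%:R) fn0 => z f fn0.
  by field; rewrite fn0 xn0.
by rewrite ler_wpM2l// mulr_ge0 ?ltW.
Qed.

Lemma is_derive_flat_fun m x :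
  is_derive x (1 : R) (flat_fun m) (flat_fun m.+2 x - m%:R * flat_fun m.+1 x).
Proof.
have [x0|x0|->] := ltgtP x 0.
- apply: (@near_eq_is_derive _ _ _ (cst 0)).
    near=> y; rewrite /flat_fun ifN// -leNgt; apply: ltW; near: y.
    exact: lt_nbhsl.
  rewrite /flat_fun !ifN -?leNgt ?ltW// mulr0 subr0.
  exact: is_derive_cst.
- apply: (@near_eq_is_derive R R R (fun y : R => y^-1 ^+ m * expR (- y^-1))). 
    by near=> y; rewrite /flat_fun ifT//; near: y; exact: lt_nbhsr.
  have xn0 : x != 0 by rewrite gt_eqF.
  have dV : is_derive x (1 : R) (fun y : R => y^-1) (- x ^- 2 *: (1 : R)).
    exact: is_deriveV.
  have dNV : is_derive x (1 : R) (fun y : R => - y^-1) (- (- x ^- 2 *: (1 : R))).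
    exact: is_deriveN.
  have dE : is_derive x (1 : R) (fun y : R => expR (- y^-1))
      (expR (- x^-1) * (- (- x ^- 2 *: (1 : R)))).
    exact: is_derive1_comp.
  have dX : is_derive x (1 : R) (fun y : R => y^-1 ^+ m)
      ((m%:R * x^-1 ^+ m.-1) *: (- x ^- 2 *: (1 : R))).
    by have := is_deriveX m dV; rewrite exprfctE.
  apply: (is_derive_eq (is_deriveM dX dE)).
  rewrite /flat_fun !ifT// /GRing.scale /= -exprVn.
  case: m {dX} => [|m] /=; first by rewrite !expr0 !exprS; ring.
  rewrite !exprS; ring.
- rewrite /flat_fun ltxx mulr0 subr0.
  suff H : (fun h : R =>
      h^-1 *: ((flat_fun m \o shift 0) (h *: 1) - flat_fun m 0)) @ 0^' --> (0 : R).
    by split; [apply/cvg_ex; exists 0|exact: cvg_lim H].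
  apply/cvgrPdist_le => e e0.
  have f0 : 0 < (m.+2)`!%:R :> R by rewrite ltr0n fact_gt0.
  exists (e / (m.+2)`!%:R) => [|h]; rewrite /ball_ /= ?divr_gt0// sub0r normrN.
  move=> he h0; rewrite sub0r normrN addr0 [h%:A]mulr1.
  rewrite [flat_fun m 0]/flat_fun ltxx subr0.
  (* The difference quotient at 0 is again a member of the family, so [flat_fun_le] with the next
     index shows that it tends to 0. *)
  have -> : h^-1 *: flat_fun m h = flat_fun m.+1 h.
    rewrite /flat_fun; case: ifP; rewrite ?scaler0// => _.
    by rewrite /GRing.scale /= mulrA -exprS.
  apply: (le_trans (flat_fun_le _ _)).
  by rewrite mulrC -ler_pdivlMr// ltW.
Unshelve. all: by end_near. Qed.

Lemma Ck_flat_fun k m (U : set R) : open U -> Ck k U (flat_fun m).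
Proof.
move=> oU.
have df m' x : differentiable (flat_fun m') x.
  by apply/derivable1_diffP; have [] := is_derive_flat_fun m' x.
elim: k m => [|k IH] m.
  by move=> x _; exact: differentiable_continuous.
split=> // v.
apply: (@Ck_eq _ _ _ _ _ ((fun x => (cst v x) *: flat_fun m.+2 x) +
  (fun x => cst (- (v * m%:R)) x *: flat_fun m.+1 x))) => //.
  move=> x _; have -> : 'D_v (flat_fun m) x = v * 'D_1 (flat_fun m) x.
    rewrite !(deriveE _ (df m x)) -[X in 'd _ _ X = _](mulr1 v).
    by rewrite -[v * 1]/(v *: (1 : R)) linearZ.
  have [_ ->] := is_derive_flat_fun m x.
  by rewrite !fctE /cst /GRing.scale /=; ring.
by apply: CkD => //; apply: Ck_scale => //; exact: Ck_cst.
Qed.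

Variable n : nat.

(** A sum of squares is smooth in [y], unlike the maximum norm of ['rV[R]_n]. The support still lies
    in the closed ball of radius [r] for that norm, since one coordinate exceeding [r] makes the sum
    exceed [r ^+ 2]. *)
Definition bump (p : 'rV[R]_n) (r : R) (y : 'rV[R]_n) : R :=
  flat_fun 0 (r ^+ 2 - \sum_j (y - p) 0 j ^+ 2).

Lemma bump_gt0 p r : 0 < r -> bump p r p != 0.
Proof.
move=> r0; rewrite /bump big1 => [|j _]; last by rewrite subrr mxE expr0n.
by rewrite subr0 /flat_fun exprn_gt0// expr0 mul1r gt_eqF// expR_gt0.
Qed.

Lemma bump_eq0 p r y : 0 < r -> r < `|y - p| -> bump p r y = 0.
Proof.
move=> r0 ry; rewrite /bump /flat_fun ifN// -leNgt subr_le0.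
have : exists j, r < `|(y - p) 0 j|.
  apply: contrapT => /forallNP H; move: ry; apply/negP; rewrite -leNgt.
  rewrite /Num.Def.normr /= mx_normrE (bigmax_le _ (ltW r0))//= => -[i j] _.
  by rewrite ord1 leNgt; apply/negP; exact: H.
move=> [j rj]; rewrite (bigD1 j)//= ler_wpDr//.
  by apply: sumr_ge0 => i _; exact: sqr_ge0.
rewrite -(real_normK (num_real ((y - p) 0 j))).
by rewrite lerXn2r ?nnegrE ?normr_ge0 ?(ltW r0) ?(ltW rj).
Qed.

Lemma smooth_at_bump p r y : smooth_at (bump p r) y.
Proof.
rewrite /bump.
apply: (@smooth_at_comp _ _ _ _
  (fun y : 'rV[R]_n => r ^+ 2 - \sum_j (y - p) 0 j ^+ 2) (flat_fun 0)).
- exact: finite_coords_R.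
- exists setT => [|k]; first by split => //; exact: openT.
  have oT : open [set: 'rV[R]_n] by exact: openT.
  have Cc j : Ck k setT (fun y : 'rV[R]_n => (y - p) 0 j).
    pose L := @coord_fun R n j.
    apply: (@Ck_eq _ _ _ _ _ ((L : _ -> R) + cst (- p 0 j))) => //.
      by move=> z _; rewrite !fctE !mxE.
    apply: CkD => //; last exact: Ck_cst.
    by apply: Ck_linear_id => //; exact: coord_continuous.
  apply: (@Ck_eq _ _ _ _ _ (cst (r ^+ 2) +
      \sum_j (fun y : 'rV[R]_n => -1 *: ((y - p) 0 j *: (y - p) 0 j : R)))) => //.
    move=> z _; rewrite !fctE fct_sumE -sumrN; congr (_ + _).
    by apply: eq_bigr => j _; rewrite scaleN1r expr2.
  apply: CkD => //; first exact: Ck_cst.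
  apply: Ck_sum => // j.
  apply: (@Ck_scale _ _ _ _ _ (cst (-1))) => //; first exact: Ck_cst.
  exact: Ck_scale.
- exists setT => [|k]; first by split => //; exact: openT.
  by apply: Ck_flat_fun; exact: openT.
Qed.

End Bump.

(** * Charts *)

Section Charts.
Context {R : realType} {n : nat} {M : manifold R n}.
Implicit Types (i j l : chart_index M) (x : M).

Definition transition i j : 'rV[R]_n -> 'rV[R]_n := chart j \o chart_inv i.

Lemma near_chart_dom i x : chart_dom i x -> \forall y \near x, chart_dom i y.
Proof. by move=> ix; apply: open_nbhs_nbhs; split => //; exact: dom_open. Qed.

Lemma near_chart_inv i x : chart_dom i x ->
  \forall y \near chart i x,
    chart_dom i (chart_inv i y) /\ chart i (chart_inv i y) = y.
Proof.
move=> ix; have : nbhs (chart i x) (chart i @` chart_dom i).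
  by apply: open_nbhs_nbhs; split; [exact: image_open|exists x].
by apply: filterS => _ [z iz <-]; rewrite chartK.
Qed.

Lemma near_chart_inv_dom i x (P : set M) : chart_dom i x -> nbhs x P ->
  \forall y \near chart i x, P (chart_inv i y).
Proof.
move=> ix Px; have := chart_inv_continuous ix; rewrite /prop_for /continuous_at.
by rewrite chartK// => /(_ _ Px).
Qed.

Lemma smooth_transition i j x : chart_dom i x -> chart_dom j x ->
  smooth_at (transition i j) (chart i x).
Proof. exact: chart_compatible. Qed.

Lemma diff_transition i j x : chart_dom i x -> chart_dom j x ->
  differentiable (transition i j) (chart i x).
Proof. by move=> ix jx; apply/smooth_at_diff/smooth_transition. Qed.

Lemma transitionE i j x : chart_dom i x -> transition i j (chart i x) = chart j x.
Proof. by move=> ix; rewrite /transition /= chartK. Qed.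

(** The change of components of tangent vectors at [x] from chart [i] to chart [j]. *)
Definition tr_diff i j x (v : 'rV[R]_n) : 'rV[R]_n :=
  'd (transition i j) (chart i x) v.

Section ChangeOfChart.
Variables (V : normedModType R) (g : V -> M) (w : V).
Hypothesis gc : {for w, continuous g}.

Lemma near_chart_comp i j : chart_dom i (g w) ->
  \forall z \near w, (transition i j \o (chart i \o g)) z = (chart j \o g) z.
Proof.
move=> iw.
have H : \forall z \near w, chart_dom i (g z) by exact: gc (near_chart_dom iw).
apply: filterS H => z /= iz.
by rewrite /transition /= chartK.
Qed.

Lemma diff_change_chart i j : chart_dom i (g w) -> chart_dom j (g w) ->
  differentiable (chart i \o g) w ->
  differentiable (chart j \o g) w /\ forall v,
  'd (chart j \o g) w v = tr_diff i j (g w) ('d (chart i \o g) w v).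
Proof.
move=> iw jw dg.
have dt := diff_transition iw jw.
have dc : differentiable (transition i j \o (chart i \o g)) w.
  exact: differentiable_comp.
have [dd E] := @near_eq_diff _ _ _ (transition i j \o (chart i \o g))
  (chart j \o g) _ (near_chart_comp j iw) dc.
split; first exact: dd.
move=> v.
have E1 := congr1 (fun F => F v) E.
have E2 := congr1 (fun F => F v) (diff_comp dg dt).
exact: etrans E1 E2.
Qed.

End ChangeOfChart.

Lemma diff_change_source (E : normedModType R) (F : M -> E) i j x :
  chart_dom i x -> chart_dom j x ->
  differentiable (F \o chart_inv i) (chart i x) ->
  differentiable (F \o chart_inv j) (chart j x) /\ forall v,
  'd (F \o chart_inv j) (chart j x) v =
  'd (F \o chart_inv i) (chart i x) (tr_diff j i x v).
Proof.
move=> ix jx dF.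
have dt := diff_transition jx ix.
have dF' : differentiable (F \o chart_inv i) (transition j i (chart j x)).
  by rewrite transitionE.
have dc : differentiable ((F \o chart_inv i) \o transition j i) (chart j x).
  exact: differentiable_comp.
have nE : \forall y \near chart j x,
    ((F \o chart_inv i) \o transition j i) y = (F \o chart_inv j) y.
  have := near_chart_inv_dom jx (near_chart_dom ix).
  by apply: filterS => y iy; rewrite /transition /= chartK.
have [dd Ed] := @near_eq_diff _ _ _ ((F \o chart_inv i) \o transition j i)
  (F \o chart_inv j) _ nE dc.
split; first exact: dd.
move=> v.
have E1 := congr1 (fun F => F v) Ed.
have E2 := congr1 (fun F => F v) (diff_comp dt dF').
apply: (etrans (etrans E1 E2)).
by rewrite -(transitionE i jx).
Qed.

(** The cocycle rule is [diff_change_source] for the map [chart l] out of [M]. *)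
Lemma tr_diff_comp i j l x v :
  chart_dom i x -> chart_dom j x -> chart_dom l x ->
  tr_diff j l x (tr_diff i j x v) = tr_diff i l x v.
Proof.
move=> ix jx lx.
have [_ E] := @diff_change_source _ (chart l) j i x jx ix (diff_transition jx lx).
exact: (esym (E v)).
Qed.

Lemma tr_diff_id i x v : chart_dom i x -> tr_diff i i x v = v.
Proof.
move=> ix; have nE : \forall y \near chart i x, id y = transition i i y.
  by have := near_chart_inv ix; apply: filterS => y [_ /esym].
have did : is_diff (chart i x) (@id 'rV[R]_n) id by exact: is_diff_id.
have [d1 d2] := did.
have [_ E] := @near_eq_diff _ _ _ (@id 'rV[R]_n) (transition i i) _ nE d1.
exact: (etrans (congr1 (@^~ v) E) (congr1 (@^~ v) d2)).
Qed.

Lemma tr_diffK i j x v : chart_dom i x -> chart_dom j x ->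
  tr_diff j i x (tr_diff i j x v) = v.
Proof. by move=> ix jx; rewrite tr_diff_comp// tr_diff_id. Qed.

Lemma tr_diff_linear i j x : linear (tr_diff i j x).
Proof. by move=> a u v; rewrite /tr_diff linearP. Qed.

HB.instance Definition _ i j x :=
  GRing.isLinear.Build R 'rV[R]_n 'rV[R]_n *:%R (tr_diff i j x)
    (tr_diff_linear i j x).

Lemma tr_diff0 i j x : tr_diff i j x 0 = 0.
Proof. exact: linear0. Qed.

Lemma tr_diffZ i j x a v : tr_diff i j x (a *: v) = a *: tr_diff i j x v.
Proof. exact: linearZ. Qed.

Lemma tr_diffB i j x u v :
  tr_diff i j x (u - v) = tr_diff i j x u - tr_diff i j x v.
Proof. exact: linearB. Qed.

Lemma tr_diff_sum i j x m (v : 'I_m -> 'rV[R]_n) :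
  tr_diff i j x (\sum_l v l) = \sum_l tr_diff i j x (v l).
Proof. exact: linear_sum. Qed.

(* Deciding whether two differentials ['d f x] agree by unfolding them is
   prohibitively slow, hence the opaque names [tr_diff] and [dphi] below. *)
#[local] Opaque tr_diff.

Lemma chart_coordE i x (v : tspace x) : chart_coord i v = tr_diff (chart_at x) i x v.
Proof. by []. Qed.

Lemma of_chart_coordE i x (w : 'rV[R]_n) :
  of_chart_coord i x w = tr_diff i (chart_at x) x w.
Proof. by []. Qed.

Lemma of_chart_coordK i x (w : 'rV[R]_n) : chart_dom i x ->
  chart_coord i (of_chart_coord i x w) = w.
Proof.
by move=> ix; rewrite chart_coordE of_chart_coordE tr_diffK//; exact: chart_atP.
Qed.

Lemma chart_coord_at x (v : tspace x) : chart_coord (chart_at x) v = v.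
Proof. by rewrite chart_coordE tr_diff_id//; exact: chart_atP. Qed.

Lemma vfield_repE (X : vfield M) i x : chart_dom i x ->
  vfield_rep X i (chart i x) = chart_coord i (X x).
Proof. by move=> ix; rewrite /vfield_rep chartK. Qed.

Lemma deriv_within_change_chart (A : set R) (c : R -> M) t (l' : 'rV[R]_n) i j :
  c @ within A (nbhs t) --> c t -> chart_dom i (c t) -> chart_dom j (c t) ->
  deriv_within A (chart i \o c) t l' ->
  deriv_within A (chart j \o c) t (tr_diff i j (c t) l').
Proof.
move=> cc it jt dc.
have := deriv_within_comp dc (diff_transition it jt).
apply: deriv_within_eq; last by rewrite /= /transition /= chartK.
have H : \forall s \near t, A s -> chart_dom i (c s) by exact: cc (near_chart_dom it).
by apply: filterS H => s H As; split => //; rewrite /transition /= chartK//; exact: H.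
Qed.

Lemma velocity_chart (A : set R) (c : R -> M) t (v : tspace (c t)) i :
  @velocity R n M A c t v -> chart_dom i (c t) ->
  deriv_within A (chart i \o c) t (chart_coord i v).
Proof.
by move=> [cc dc] it; apply: deriv_within_change_chart => //; exact: chart_atP.
Qed.

(** Supplies globally smooth test fields: a coordinate field of chart [i] times a bump function,
    extended by zero. *)
Lemma exists_bump_vfield i x (k : 'I_n) : chart_dom i x ->
  exists (Y : vfield M) (r : 'rV[R]_n -> R), [/\ smooth_vfield setT Y,
    forall y, smooth_at r y, r (chart i x) != 0 &
    forall z, chart_dom i z ->
      Y z = r (chart i z) *: of_chart_coord i z (delta_mx 0 k)].
Proof.
move=> ix; set p := chart i x.
have /nbhs_ballP[e /= e0 He] : nbhs p (chart i @` chart_dom i).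
  by apply: open_nbhs_nbhs; split; [exact: image_open|exists x].
(* Half the radius, so that the closed ball [B] still lies in the image of the chart. *)
pose r := e / 2.
have r0 : 0 < r by rewrite divr_gt0.
have re : r < e by rewrite ltr_pdivrMr// ltr_pMr// ltr1n.
pose B := [set y : 'rV[R]_n | `|y - p| <= r].
have BI y : B y -> (chart i @` chart_dom i) y.
  by move=> By; apply: He; rewrite -ball_normE /ball_ /= distrC (le_lt_trans By).
have Bcl : closed B.
  rewrite (_ : B = closed_ball p r); first exact: closed_ball_closed.
  by rewrite closed_ballE//; apply/funext => y; rewrite /B /closed_ball_ /= distrC.
have Bbd : bounded_set B.
  exists (r + `|p|); split; first exact: num_real.
  move=> z rz y By; rewrite /mkset -(subrK p y).
  apply: (le_trans (ler_normD _ _)); apply: le_trans (ltW rz).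
  by rewrite lerD2r.
have Bco : compact B by exact: bounded_closed_compact.
pose K := chart_inv i @` B.
(* [K] is compact in a Hausdorff space, so its complement is an open set on which the field
   vanishes; this gives smoothness at points outside the domain of chart [i]. *)
have Kcl : closed K.
  apply: compact_closed; first exact: manifold_hausdorff.
  apply: continuous_compact => //; apply: continuous_in_subspaceT => y.
  rewrite inE => /BI[z iz <-]; exact: chart_inv_continuous.
pose Y : vfield M := fun z =>
  if `[< chart_dom i z >] then
    bump p r (chart i z) *: (of_chart_coord i z (delta_mx 0 k) : 'rV[R]_n)
  else 0.
have YE z : chart_dom i z ->
    Y z = bump p r (chart i z) *: of_chart_coord i z (delta_mx 0 k).
  by move=> iz; rewrite /Y; case: asboolP.
exists Y, (bump p r); split => //; last 2 first.
- exact: smooth_at_bump.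
- exact: bump_gt0.
move=> z l _ lz.
have [iz|niz] := pselect (chart_dom i z).
  have sli := smooth_transition lz iz.
  (* In chart [l] the coordinate field [k] of chart [i] is column [k] of the Jacobian of
     [transition i l], evaluated after [transition l i]. *)
  apply: (@smooth_at_near _ _ _
    (fun y => (bump p r \o transition l i) y *:
       ('D_(delta_mx 0 k) (transition i l) \o transition l i) y)).
    near=> y; rewrite /vfield_rep.
    have ily : chart_dom i (chart_inv l y).
      by near: y; exact: (near_chart_inv_dom lz (near_chart_dom iz)).
    have lly : chart_dom l (chart_inv l y).
      by near: y; exact: (near_chart_inv_dom lz (near_chart_dom lz)).
    rewrite YE// chart_coordE tr_diffZ of_chart_coordE tr_diff_comp//;
      last exact: chart_atP.
    congr (_ *: _); rewrite /= deriveE; last exact: diff_transition.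
    by [].
  apply: smooth_at_scale.
    by apply: smooth_at_comp => //; [exact: finite_coords_rV|exact: smooth_at_bump].
  apply: smooth_at_comp => //; first exact: finite_coords_rV.
  by rewrite transitionE//; apply: smooth_at_derive; exact: smooth_transition.
have zK : ~ K z by move=> [y /BI [u iu <-]]; rewrite chartK// => uz; rewrite -uz in niz.
have nK : nbhs z (~` K).
  by apply: open_nbhs_nbhs; split => //; exact: closed_openC.
apply: (@smooth_at_near R 'rV[R]_n 'rV[R]_n (cst 0)); last exact: smooth_at_cst.
near=> y.
have nKy : ~ K (chart_inv l y) by near: y; exact: (near_chart_inv_dom lz nK).
rewrite /vfield_rep /Y; case: asboolP => iy; last by rewrite chart_coordE tr_diff0.
rewrite bump_eq0//; first by rewrite scale0r chart_coordE tr_diff0.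
rewrite ltNge; apply/negP => By; apply: nKy; exists (chart i (chart_inv l y)) => //.
by rewrite chartK.
Unshelve. all: by end_near. Qed.

End Charts.

(** * Flows *)

Lemma pairl_continuous (S T : topologicalType) (y : T) :
  continuous (fun s : S => (s, y)).
Proof. by move=> s; apply: cvg_pair => //=; exact: cvg_cst. Qed.

Lemma pairr_continuous (S T : topologicalType) (s : S) :
  continuous (fun y : T => (s, y)).
Proof. by move=> y; apply: cvg_pair => //=; exact: cvg_cst. Qed.

Lemma fst_continuous (S T : topologicalType) : continuous (fst : S * T -> S).
Proof. by move=> x; exact: cvg_fst. Qed.

Lemma snd_continuous (S T : topologicalType) : continuous (snd : S * T -> T).
Proof. by move=> x; exact: cvg_snd. Qed.

Lemma pair_continuous (E S T : topologicalType) (f : E -> S) (g : E -> T) x :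
  {for x, continuous f} -> {for x, continuous g} ->
  {for x, continuous (fun z => (f z, g z))}.
Proof. by move=> fc gc; apply: cvg_pair. Qed.

Section Partial.
Context {R : realType} {V W : normedModType R}.
Variables (f : R * V -> W) (s : R) (y : V).
Hypothesis df : differentiable f (s, y).

(** Time and space derivatives are both written as directional derivatives on the product, the form
    in which [derive_comm] exchanges them. *)
Lemma is_derive_partial1 :
  is_derive s (1 : R) (fun s => f (s, y)) ('D_(1, 0) f (s, y)).
Proof.
have di : is_diff s (fun s : R => (s, y)) (fun s => (s, 0)).
  exact: (is_diff_pair (is_diff_id s) (is_diff_cst y s)).
have [d1 d2] := di.
have dc : differentiable (f \o (fun s : R => (s, y))) s.
  exact: differentiable_comp.
split; first exact: (diff_derivable dc).
have E1 := deriveE (1 : R) dc.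
have E2 := congr1 (fun F => F (1 : R)) (diff_comp d1 df).
have E3 := congr1 (fun F => F (1 : R)) d2.
rewrite /= in E2 E3.
apply: (etrans (etrans E1 E2)); rewrite E3.
by rewrite (deriveE _ df).
Qed.

Lemma diff_partial2 :
  differentiable (fun y => f (s, y)) y /\
  forall v, 'd (fun y => f (s, y)) y v = 'D_(0, v) f (s, y).
Proof.
have di : is_diff y (fun y : V => (s, y)) (fun y => (0, y)).
  exact: (is_diff_pair (is_diff_cst s y) (is_diff_id y)).
have [d1 d2] := di.
have dc : differentiable (f \o (fun y : V => (s, y))) y.
  exact: differentiable_comp.
split; first exact: dc.
move=> v.
have E2 := congr1 (fun F => F v) (diff_comp d1 df).
have E3 := congr1 (fun F => F v) d2.
rewrite /= in E2 E3.
apply: (etrans E2); rewrite E3.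
by rewrite (deriveE _ df).
Qed.

End Partial.

Section Shift.
Context {R : realType}.

Lemma cvg_within_shift (T : topologicalType) (A : set R) (f : R -> T)
    (t r : R) (l : T) :
  f @ within A (nbhs (t + r)) --> l ->
  (fun s => f (s + r)) @ within [set s | A (s + r)] (nbhs t) --> l.
Proof.
move=> fl P /fl [e /= e0 He]; exists e => //= s ts As.
by apply: He => //; rewrite /ball_ /= opprD addrACA subrr addr0.
Qed.

Lemma deriv_within_shift (V : normedModType R) (A : set R) (f : R -> V)
    (t r : R) (l : V) :
  deriv_within A f (t + r) l ->
  deriv_within [set s | A (s + r)] (fun s => f (s + r)) t l.
Proof.
move=> fl P /fl [e /= e0 He]; exists e => //= s ts st As.
have E (u v : R) : (u + r) - (v + r) = u - v by rewrite opprD addrACA subrr addr0.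
have := He (s + r); rewrite /ball_ /= !E; apply => //.
by apply: contra st => /eqP/addIr/eqP.
Qed.

End Shift.

Section Flow.
Context {R : realType} {n : nat} {M : manifold R n}.
Variables (U : set M) (X : vfield M) (D : set (R * M)) (phi : R -> M -> M).
Hypotheses (HX : smooth_vfield U X) (Hphi : local_flow U X D phi).
Implicit Types (i j l : chart_index M) (x : M).

Lemma flow_fiber_open x : open [set s | D (s, x)].
Proof.
have -> : [set s | D (s, x)] = (fun s => (s, x)) @^-1` D by [].
apply: open_comp; last exact: flow_dom_open Hphi.
by move=> s _; exact: pairl_continuous.
Qed.

Lemma flow_fiber_nbhs s x : D (s, x) -> nbhs s [set s | D (s, x)].
Proof. by move=> Dsx; apply: open_nbhs_nbhs; split => //; exact: flow_fiber_open. Qed.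

(** The translated flow line [s |-> phi (s + r) x] is an integral curve through [phi r x] at time 0,
    so maximality of the flow identifies it with the flow line of that point. *)
Lemma flow_group r s x : D (r, x) -> D (s + r, x) ->
  D (s, phi r x) /\ phi s (phi r x) = phi (s + r) x.
Proof.
move=> Dr Dsr.
have := @flow_maximal _ _ _ _ _ _ _ Hphi [set s | D (s + r, x)]
  (fun s => phi (s + r) x).
rewrite add0r; apply => //.
- have -> : [set s | D (s + r, x)] = (fun s => s + r) @^-1` [set s | D (s, x)].
    by [].
  apply: open_comp; last exact: flow_fiber_open.
  by move=> z _; apply: cvgD; [exact: cvg_id|exact: cvg_cst].
- move=> u v Du Dv w /andP[uw wv].
  by apply: (flow_dom_interval Hphi Du Dv); rewrite !lerD2r uw wv.
- by rewrite /= add0r.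
- by move=> z Dz; exact: (flow_stays Hphi Dz).
- move=> z Dz; have [cz dz] := flow_velocity Hphi Dz; split.
    exact: (@cvg_within_shift _ _ [set r | D (r, x)] (phi^~ x)).
  exact: (@deriv_within_shift R 'rV[R]_n _ _ z r _ dz).
Qed.

Lemma flow_opp r x : D (r, x) -> D (- r, phi r x) /\ phi (- r) (phi r x) = x.
Proof.
move=> Dr; have [D0 p0] := flow0 Hphi (flow_dom_sub Hphi Dr).
have := @flow_group r (- r) x Dr; rewrite addNr => /(_ D0) [D1 ->].
by split.
Qed.

(** The differential of [phi s] with both charts left free; [tmap] is the case of the preferred
    charts. A fixed target chart is needed to differentiate in [s]. *)
Definition dphi i j (s : R) (x : M) (v : 'rV[R]_n) : 'rV[R]_n :=
  'd (chart j \o phi s \o chart_inv i) (chart i x) v.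

Lemma tmap_dphi s x (v : tspace x) :
  tmap (phi s) v = dphi (chart_at x) (chart_at (phi s x)) s x v.
Proof. by []. Qed.

Definition flow_rep i j (z : R * 'rV[R]_n) : 'rV[R]_n :=
  chart j (phi z.1 (chart_inv i z.2)).

Lemma smooth_flow_rep i j s x : D (s, x) -> chart_dom i x ->
  chart_dom j (phi s x) -> smooth_at (flow_rep i j) (s, chart i x).
Proof.
move=> Dsx ix jx; have [_ H] := flow_smooth Hphi Dsx ix.
by apply: H => /=; rewrite chartK.
Qed.

Lemma flow_continuous i s x : D (s, x) -> chart_dom i x ->
  {for chart i x, continuous (fun y => phi s (chart_inv i y))}.
Proof.
move=> Dsx ix; have [H _] := flow_smooth Hphi Dsx ix.
apply: (@continuous_comp _ _ _ (fun y => (s, y))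
  (fun z : R * 'rV[R]_n => phi z.1 (chart_inv i z.2))) => //.
exact: pairr_continuous.
Qed.

Lemma diff_flow i j s x : D (s, x) -> chart_dom i x -> chart_dom j (phi s x) ->
  differentiable (chart j \o phi s \o chart_inv i) (chart i x).
Proof.
move=> Dsx ix jx.
by have [] := diff_partial2 (smooth_at_diff (smooth_flow_rep Dsx ix jx)).
Qed.

Lemma dphi_partial i j s x v : D (s, x) -> chart_dom i x ->
  chart_dom j (phi s x) ->
  dphi i j s x v = 'D_(0, v) (flow_rep i j) (s, chart i x).
Proof.
move=> Dsx ix jx.
have [_ E] := diff_partial2 (smooth_at_diff (smooth_flow_rep Dsx ix jx)).
exact: E.
Qed.

Lemma dphi_linear i j s x : linear (dphi i j s x).
Proof. by move=> a u v; rewrite /dphi linearP. Qed.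

HB.instance Definition _ i j s x :=
  GRing.isLinear.Build R 'rV[R]_n 'rV[R]_n *:%R (dphi i j s x)
    (dphi_linear i j s x).

Lemma dphi_target i j j' s x v : D (s, x) -> chart_dom i x ->
  chart_dom j (phi s x) -> chart_dom j' (phi s x) ->
  dphi i j' s x v = tr_diff j j' (phi s x) (dphi i j s x v).
Proof.
move=> Dsx ix jx jx'.
have g0 : phi s (chart_inv i (chart i x)) = phi s x by rewrite chartK.
have [|||_ E] := @diff_change_chart _ _ _ _ (fun y => phi s (chart_inv i y))
  (chart i x) (flow_continuous Dsx ix) j j'.
- by rewrite g0.
- by rewrite g0.
- exact: diff_flow.
- by apply: (etrans (E v)); rewrite g0.
Qed.

Lemma dphi_source i i' j s x v : D (s, x) -> chart_dom i x ->
  chart_dom i' x -> chart_dom j (phi s x) ->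
  dphi i' j s x v = dphi i j s x (tr_diff i' i x v).
Proof.
move=> Dsx ix ix' jx.
have [_ E] := @diff_change_source _ _ _ _ (chart j \o phi s) i i' x ix ix'
  (diff_flow Dsx ix jx).
exact: E.
Qed.

Lemma dphi0 i x v : U x -> chart_dom i x -> dphi i i 0 x v = v.
Proof.
move=> Ux ix.
(* That [U] is a neighbourhood of [x] is read off from the openness of [D] at time 0. *)
have Un : nbhs x U.
  have [D0 p0] := flow0 Hphi Ux.
  have [[A B] /= [A0 Bx] AB] : nbhs ((0 : R), x) D.
    by apply: open_nbhs_nbhs; split => //; exact: flow_dom_open Hphi.
  apply: filterS Bx => y By; apply: (flow_dom_sub Hphi (s := 0)).
  by apply: AB; split => //=; exact: nbhs_singleton A0.
have nE : \forall y \near chart i x, id y = (chart i \o phi 0 \o chart_inv i) y.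
  near=> y.
  have Uy : U (chart_inv i y) by near: y; exact: near_chart_inv_dom.
  have [_ /= ->] := flow0 Hphi Uy.
  have [_ ->//] : chart_dom i (chart_inv i y) /\ chart i (chart_inv i y) = y.
  by near: y; exact: near_chart_inv.
have did : is_diff (chart i x) (@id 'rV[R]_n) id by exact: is_diff_id.
have [d1 d2] := did.
have [_ E] := @near_eq_diff _ _ _ (@id 'rV[R]_n)
  (chart i \o phi 0 \o chart_inv i) _ nE d1.
exact: (etrans (congr1 (@^~ v) E) (congr1 (@^~ v) d2)).
Unshelve. all: by end_near. Qed.

Lemma near_flow_dom s x : D (s, x) ->
  \forall y \near x, D (s, y).
Proof.
move=> Dsx; have [[A B] /= [A0 Bx] AB] : nbhs (s, x) D.
  by apply: open_nbhs_nbhs; split => //; exact: flow_dom_open Hphi.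
by apply: filterS Bx => y By; apply: AB; split => //=; exact: nbhs_singleton A0.
Qed.

Lemma dphi_group i j l r s x v : D (r, x) -> D (s + r, x) ->
  chart_dom i x -> chart_dom j (phi r x) -> chart_dom l (phi (s + r) x) ->
  dphi i l (s + r) x v = dphi j l s (phi r x) (dphi i j r x v).
Proof.
move=> Dr Dsr ix jx lx; have [Ds ps] := flow_group Dr Dsr.
have df1 := diff_flow Dr ix jx.
have lx' : chart_dom l (phi s (phi r x)) by rewrite ps.
have df2 := diff_flow Ds jx lx'.
have p0 : (chart j \o phi r \o chart_inv i) (chart i x) = chart j (phi r x).
  by rewrite /= chartK.
have df2' : differentiable (chart l \o phi s \o chart_inv j)
    ((chart j \o phi r \o chart_inv i) (chart i x)) by rewrite p0.
have dc := differentiable_comp df1 df2'.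
have nE : \forall y \near chart i x,
    ((chart l \o phi s \o chart_inv j) \o (chart j \o phi r \o chart_inv i)) y =
    (chart l \o phi (s + r) \o chart_inv i) y.
  near=> y.
  have jy : chart_dom j (phi r (chart_inv i y)).
    near: y; apply: (flow_continuous Dr ix); rewrite chartK//.
    exact: near_chart_dom.
  have Dry : D (r, chart_inv i y).
    by near: y; exact: (near_chart_inv_dom ix (near_flow_dom Dr)).
  have Dsry : D (s + r, chart_inv i y).
    by near: y; exact: (near_chart_inv_dom ix (near_flow_dom Dsr)).
  by rewrite /= chartK//; have [_ ->] := flow_group Dry Dsry.
have [_ E] := @near_eq_diff _ _ _
  ((chart l \o phi s \o chart_inv j) \o (chart j \o phi r \o chart_inv i))
  (chart l \o phi (s + r) \o chart_inv i) _ nE dc.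
have E1 := congr1 (fun F => F v) E.
have E2 := congr1 (fun F => F v) (diff_comp df1 df2').
apply: (etrans (etrans E1 E2)) => /=.
by rewrite /dphi -p0.
Unshelve. all: by end_near. Qed.

Lemma dphiK i j r x v : D (r, x) -> chart_dom i x -> chart_dom j (phi r x) ->
  dphi j i (- r) (phi r x) (dphi i j r x v) = v.
Proof.
move=> Dr ix jx; have Ux := flow_dom_sub Hphi Dr.
have [D0 p0] := flow0 Hphi Ux.
rewrite -(@dphi_group i j i r (- r) x)// ?addNr//; first exact: dphi0.
by rewrite p0.
Qed.

Lemma dphiVK i j r x w : D (r, x) -> chart_dom i x -> chart_dom j (phi r x) ->
  dphi i j r x (dphi j i (- r) (phi r x) w) = w.
Proof.
move=> Dr ix jx; have [Dm pm] := flow_opp Dr.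
have := @dphiK j i (- r) (phi r x) w Dm jx.
by rewrite pm opprK; apply.
Qed.

Lemma dphi_variational i j s x v : D (s, x) -> chart_dom i x ->
  chart_dom j (phi s x) ->
  is_derive s (1 : R) (fun r => dphi i j r x v)
    ('d (vfield_rep X j) (chart j (phi s x)) (dphi i j s x v)).
Proof.
move=> Dsx ix jx; set y0 := chart i x.
have sF := smooth_flow_rep Dsx ix jx.
have [W [oW Wp] CW] := sF.
have Fp : flow_rep i j (s, y0) = chart j (phi s x) by rewrite /flow_rep /= chartK.
have Us : U (phi s x) by exact: (flow_stays Hphi Dsx).
have dX : differentiable (vfield_rep X j) (flow_rep i j (s, y0)).
  by rewrite Fp; apply: smooth_at_diff; exact: HX.
have near1 : \forall z \near (s, y0), [/\ D (z.1, chart_inv i z.2),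
    chart_dom i (chart_inv i z.2) , chart i (chart_inv i z.2) = z.2 &
    chart_dom j (phi z.1 (chart_inv i z.2))].
  have N1 : \forall z \near (s, y0), D (z.1, chart_inv i z.2).
    have c1 : {for (s, y0), continuous (fun z : R * 'rV[R]_n => (z.1, chart_inv i z.2))}.
      apply: pair_continuous; first exact: fst_continuous.
      apply: (@continuous_comp _ _ _ snd (chart_inv i)); first exact: snd_continuous.
      exact: chart_inv_continuous.
    apply: c1; rewrite /= chartK//.
    by apply: open_nbhs_nbhs; split => //; exact: flow_dom_open Hphi.
  have N2 : \forall z \near (s, y0), chart_dom i (chart_inv i z.2) /\
      chart i (chart_inv i z.2) = z.2.
    have c2 : {for (s, y0), continuous (@snd R 'rV[R]_n)}.
      exact: snd_continuous.
    exact: (c2 _ (near_chart_inv ix)).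
  have N3 : \forall z \near (s, y0), chart_dom j (phi z.1 (chart_inv i z.2)).
    have [c3 _] := flow_smooth Hphi Dsx ix.
    by apply: c3; rewrite /= chartK//; exact: near_chart_dom.
  near=> z.
  have [H1 H2] : chart_dom i (chart_inv i z.2) /\ chart i (chart_inv i z.2) = z.2.
    by near: z; exact: N2.
  by split => //; near: z.
(* The flow equation is needed on a full neighbourhood of [(s, y0)], because it is differentiated in
   the space variable below. *)
have near2 : \forall z \near (s, y0),
    'D_(1, 0) (flow_rep i j) z = (vfield_rep X j \o flow_rep i j) z.
  near=> z.
  have [Dz iz ez jz] : [/\ D (z.1, chart_inv i z.2),
    chart_dom i (chart_inv i z.2) , chart i (chart_inv i z.2) = z.2 &
    chart_dom j (phi z.1 (chart_inv i z.2))] by near: z; exact: near1.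
  have dz : differentiable (flow_rep i j) (z.1, z.2).
    by rewrite -ez; apply: smooth_at_diff; exact: smooth_flow_rep.
  have [_ E1] := is_derive_partial1 dz.
  have vz := velocity_chart (flow_velocity Hphi Dz) jz.
  have [_ E2] := deriv_within_nbhs (flow_fiber_nbhs Dz) vz.
  rewrite -surjective_pairing in E1.
  rewrite -E1 /= vfield_repE//.
have nearA : \forall r \near s,
    'D_(0, v) (flow_rep i j) (r, y0) = dphi i j r x v.
  have c4 : {for s, continuous (fun r : R => (r, y0))}.
    exact: pairl_continuous.
  have near1' := c4 _ near1; near=> r.
  have [] : [/\ D (r, chart_inv i y0), chart_dom i (chart_inv i y0),
    chart i (chart_inv i y0) = y0 & chart_dom j (phi r (chart_inv i y0))].
    by near: r; exact: near1'.
  by rewrite chartK// => Dr _ _ jr; rewrite dphi_partial.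
apply: (near_eq_is_derive nearA).
have dD : differentiable ('D_(0, v) (flow_rep i j)) (s, y0).
  by apply: smooth_at_diff; exact: smooth_at_derive.
apply: (is_derive_eq (is_derive_partial1 dD)).
(* Symmetry brings the time derivative inside, where [near2] replaces it by the field; the chain
   rule then produces the differential of [X]. *)
rewrite (derive_comm _ _ oW Wp (CW 2)).
rewrite (near_eq_derive _ near2).
have dF := smooth_at_diff sF.
have dc := differentiable_comp dF dX.
have E1 := congr1 (fun F => F (0, v)) (diff_comp dF dX).
apply: (etrans (deriveE (0, v) dc)); apply: (etrans E1) => /=.
have E2 := deriveE (0, v) dF.
have E3 := dphi_partial v Dsx ix jx.
have E4 := etrans E3 E2.
rewrite E4 Fp.
reflexivity.
Unshelve. all: by end_near. Qed.

End Flow.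

#[local] Opaque dphi.

(** * Gluing velocities, and comparison of an integral curve with the flow *)

Lemma within_setU (T : Type) (F : set_system T) (A B P : set T) : Filter F ->
  within A F P -> within B F P -> within (A `|` B) F P.
Proof.
move=> FF H1 H2; have := @filterI _ F FF _ _ H1 H2.
by apply: (@filterS _ F FF) => s [{}H1 {}H2] [/H1|/H2].
Qed.

Lemma near_all (T : topologicalType) (t : T) (P : set T) :
  (forall x, P x) -> \forall x \near t, P x.
Proof. by move=> H; exact: filterE. Qed.

Section Glue.
Context {R : realType} {n : nat} {M : manifold R n}.

Lemma velocity_eq (A B : set R) (f g : R -> M) (X : vfield M) t :
  (\forall s \near t, B s -> A s /\ f s = g s) -> f t = g t ->
  @velocity R n M A f t (X (f t)) -> @velocity R n M B g t (X (g t)).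
Proof.
move=> H ft [fc fd]; split.
  rewrite -ft => P /fc fP; rewrite /= /within /= in fP *.
  apply: filterS2 H fP => s H fP Bs; have [As fs] := H Bs.
  by rewrite /preimage /= -fs; exact: fP.
rewrite -ft; apply: deriv_within_eq fd; last by rewrite /= ft.
by apply: filterS H => s H /H [As fs]; split => //=; rewrite fs.
Qed.

(** Away from a piece of the glued curve its velocity condition is empty, so every piece satisfies
    the condition at every time and all pieces can be combined uniformly. *)
Lemma velocity_vacuous (B : set R) (g : R -> M) t (v : tspace (g t)) :
  (\forall s \near t, ~ B s) -> @velocity R n M B g t v.
Proof.
move=> H; split => P _; rewrite /= /within /=; first by apply: filterS H.
by apply: nbhs_dnbhs; apply: filterS H.
Qed.

Lemma velocityU (A B : set R) (g : R -> M) t (v : tspace (g t)) :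
  @velocity R n M A g t v -> @velocity R n M B g t v ->
  @velocity R n M (A `|` B) g t v.
Proof.
move=> [ac ad] [bc bd]; split => P HP; apply: within_setU.
- exact: (ac P HP).
- exact: (bc P HP).
- exact: (ad P HP).
- exact: (bd P HP).
Qed.

Lemma velocity_shift (A : set R) (f : R -> M) (X : vfield M) (t r : R) :
  @velocity R n M A f (t + r) (X (f (t + r))) ->
  @velocity R n M [set s | A (s + r)] (fun s => f (s + r)) t (X (f (t + r))).
Proof.
move=> [fc fd]; split; first exact: cvg_within_shift.
exact: (@deriv_within_shift R 'rV[R]_n _ _ t r _ fd).
Qed.

Variables (U : set M) (X : vfield M) (D : set (R * M)) (phi : R -> M -> M).
Hypotheses (Hphi : local_flow U X D phi).

(* Prolonging [c] by the flow lines through its endpoints gives an integral curve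
   on an open interval, to which the maximality of the flow applies; no
   uniqueness theorem for differential equations is needed. *)
Lemma flow_integral_curve (a b : R) (c : R -> M) : a <= b ->
  (forall t, a <= t <= b -> U (c t)) -> integral_curve a b X c ->
  forall t, a <= t <= b -> D (t - a, c a) /\ phi (t - a) (c a) = c t.
Proof.
move=> ab HU Hc t tab; pose L := b - a.
have L0 : 0 <= L by rewrite subr_ge0.
have Ua : U (c a) by apply: HU; rewrite lexx ab.
have Ub : U (c b) by apply: HU; rewrite lexx ab.
have [Da pa] := flow0 Hphi Ua.
have [Db pb] := flow0 Hphi Ub.
(* [e1] and [e2] are lengths of time for which the flow lines of [c a] and [c b] exist; they make
   the interval [J] open around [[0, L]]. *)
have /nbhs_ballP[e1 /= e10 He1] := flow_fiber_nbhs Hphi Da.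
have /nbhs_ballP[e2 /= e20 He2] := flow_fiber_nbhs Hphi Db.
pose g s := if s < 0 then phi s (c a) else
            if s <= L then c (s + a) else phi (s - L) (c b).
pose J := [set` `]- e1, (L + e2)[].
have g0 : g 0 = c a by rewrite /g ltxx L0 add0r.
have gle s : s <= 0 -> g s = phi s (c a).
  rewrite le_eqVlt => /predU1P[->|s0]; first by rewrite g0 pa.
  by rewrite /g s0.
have gmid s : 0 <= s <= L -> g s = c (s + a).
  by move=> /andP[s0 sL]; rewrite /g ltNge s0 /= sL.
have gge s : L <= s -> g s = phi (s - L) (c b).
  rewrite le_eqVlt => /predU1P[<-|sL].
    by rewrite gmid ?L0 ?lexx// subrr pb /L subrK.
  by rewrite /g ltNge (le_trans L0 (ltW sL)) /= leNgt sL.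
have DJ1 s : s <= 0 -> J s -> D (s, c a).
  move=> s0; rewrite /J /= in_itv /= => /andP[se _]; apply: He1.
  by rewrite /ball /= sub0r normrN ler0_norm// ltrNl.
have DJ3 s : L <= s -> J s -> D (s - L, c b).
  move=> s0; rewrite /J /= in_itv /= => /andP[_ se]; apply: (He2 (s - L)).
  by rewrite /ball /= sub0r normrN ger0_norm ?subr_ge0// ltrBlDl.
have UJ s : J s -> U (g s).
  move=> Js; have [s0|s0] := leP s 0.
    by rewrite gle//; apply: (flow_stays Hphi); exact: DJ1.
  have [sL|sL] := leP s L.
    rewrite gmid ?sL ?(ltW s0)//; apply: HU.
    by rewrite lerDr (ltW s0) -lerBrDr.
  by rewrite gge ?(ltW sL)//; apply: (flow_stays Hphi); apply: DJ3 => //; exact: ltW.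
have V1 s : J s -> @velocity R n M (J `&` [set s | s <= 0]) g s (X (g s)).
  move=> Js; have [s0|s0] := leP s 0; last first.
    apply: velocity_vacuous; near=> r => -[_ /=]; apply/negP; rewrite -ltNge.
    by near: r; exact: lt_nbhsr.
  apply: (@velocity_eq [set r | D (r, c a)] _ (phi^~ (c a))).
  - by apply: near_all => r [Jr r0]; split; [exact: DJ1|rewrite gle].
  - by rewrite gle.
  - by apply: (flow_velocity Hphi); exact: DJ1.
have V2 s : @velocity R n M [set s | 0 <= s <= L] g s (X (g s)).
  have [s0|s0] := ltP s 0.
    apply: velocity_vacuous; near=> r => /= /andP[+ _]; apply/negP.
    by rewrite -ltNge; near: r; exact: lt_nbhsl.
  have [sL|sL] := leP s L; last first.
    apply: velocity_vacuous; near=> r => /= /andP[_]; apply/negP.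
    by rewrite -ltNge; near: r; exact: lt_nbhsr.
  have s0L : 0 <= s <= L by rewrite s0.
  have absa r : (a <= r + a <= b) = (0 <= r <= L).
    by rewrite lerDr -lerBrDr.
  apply: (@velocity_eq [set r | `[a, b]%classic (r + a)] _ (fun r => c (r + a))).
  - apply: near_all => r /= r0L; split; last by rewrite gmid.
    by rewrite in_itv /= absa.
  - by rewrite gmid.
  - by apply: velocity_shift; apply: Hc; rewrite absa.
have V3 s : J s -> @velocity R n M (J `&` [set s | L <= s]) g s (X (g s)).
  move=> Js; have [sL|sL] := ltP s L.
    apply: velocity_vacuous; near=> r => -[_ /=]; apply/negP; rewrite -ltNge.
    by near: r; exact: lt_nbhsl.
  apply: (@velocity_eq [set r | D (r - L, c b)] _ (fun r => phi (r - L) (c b))).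
  - by apply: near_all => r [Jr r0]; split; [exact: DJ3|rewrite gge].
  - by rewrite gge.
  - apply: (@velocity_shift [set r | D (r, c b)] (phi^~ (c b))).
    by apply: (flow_velocity Hphi); exact: DJ3.
have VJ s : J s -> @velocity R n M J g s (X (g s)).
  (* At the junctions 0 and [L] the one-sided velocities are both [X (g s)], so they combine into a
     velocity within [J]. *)
  move=> Js; apply: (@velocity_eq _ _ g _ _ _ _ _
    (velocityU (velocityU (V1 s Js) (V2 s)) (V3 s Js))) => //.
  apply: near_all => r Jr; split => //=.
  have [r0|r0] := leP r 0; first by left; left.
  have [rL|rL] := leP r L; first by left; right; rewrite (ltW r0).
  by right; split => //; exact: ltW.
have J0 : J 0 by rewrite /J /= in_itv /= oppr_lt0 e10 ltr_wpDl.
have [] := @flow_maximal _ _ _ _ _ _ _ Hphi J g _ _ J0 UJ VJ (t - a).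
- exact: itv_open.
- exact: interval_is_interval.
- move/andP: tab => [at_ tb]; rewrite /J /= in_itv /=; apply/andP; split.
    by rewrite (@lt_le_trans _ _ 0) ?oppr_lt0// subr_ge0.
  by rewrite (@le_lt_trans _ _ L) ?lerD2r// ltrDl.
rewrite g0 => H1 H2; split => //; rewrite H2 gmid ?subrK//.
by move/andP: tab => [at_ tb]; rewrite subr_ge0 at_ lerD2r.
Unshelve. all: by end_near. Qed.

End Glue.

(** * The pairing with sections of the distribution *)

Section MatrixLimits.
Context {R : realType} {T : Type} {F : set_system T} {FF : Filter F}.

(** Convergence is taken entry by entry because determinants and adjugates are polynomials in the
    entries. *)
Definition mx_cvg m p (A : T -> 'M[R]_(m, p)) (B : 'M[R]_(m, p)) :=
  forall i j, A t i j @[t --> F] --> B i j.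

Lemma cvg_sum_fun (I : Type) (r : seq I) (P : pred I) (f : I -> T -> R) (l : I -> R) :
  (forall i, P i -> f i t @[t --> F] --> l i) ->
  (\sum_(i <- r | P i) f i t) @[t --> F] --> \sum_(i <- r | P i) l i.
Proof.
move=> H; elim: r => [|i r IH].
  under eq_fun do rewrite big_nil.
  by rewrite big_nil; exact: cvg_cst.
under eq_fun do rewrite big_cons.
rewrite big_cons; case: ifP => // Pi.
by apply: cvgD => //; exact: H.
Qed.

Lemma cvg_prod_fun (I : Type) (r : seq I) (f : I -> T -> R) (l : I -> R) :
  (forall i, f i t @[t --> F] --> l i) ->
  (\prod_(i <- r) f i t) @[t --> F] --> \prod_(i <- r) l i.
Proof.
move=> H; elim: r => [|i r IH].
  under eq_fun do rewrite big_nil.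
  by rewrite big_nil; exact: cvg_cst.
under eq_fun do rewrite big_cons.
by rewrite big_cons; apply: cvgM.
Qed.

Lemma cvg_mx_cvg m p (A : T -> 'M[R]_(m, p)) B : A t @[t --> F] --> B -> mx_cvg A B.
Proof.
move=> H i j; pose h (N : 'M[R]_(m, p)) := N i j.
have hc : {for B, continuous h} by exact: coord_continuous.
exact: (continuous_cvg _ hc H).
Qed.

Lemma mx_cvg_cst m p (B : 'M[R]_(m, p)) : mx_cvg (fun=> B) B.
Proof. by move=> i j; exact: cvg_cst. Qed.

Lemma mx_cvg_mul m p q (A : T -> 'M[R]_(m, p)) A0 (B : T -> 'M[R]_(p, q)) B0 :
  mx_cvg A A0 -> mx_cvg B B0 -> mx_cvg (fun t => A t *m B t) (A0 *m B0).
Proof.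
move=> HA HB i j; rewrite mxE; under eq_fun do rewrite mxE.
by apply: cvg_sum_fun => l _; apply: cvgM.
Qed.

Lemma mx_cvg_det m (A : T -> 'M[R]_m) A0 :
  mx_cvg A A0 -> \det (A t) @[t --> F] --> \det A0.
Proof.
move=> HA; rewrite /determinant; apply: cvg_sum_fun => s _.
by apply: cvgM; [exact: cvg_cst|apply: cvg_prod_fun].
Qed.

Lemma mx_cvg_adj m (A : T -> 'M[R]_m) A0 :
  mx_cvg A A0 -> mx_cvg (fun t => \adj (A t)) (\adj A0).
Proof.
move=> HA i j; rewrite mxE; under eq_fun do rewrite mxE.
rewrite /cofactor; apply: cvgM; first exact: cvg_cst.
by apply: mx_cvg_det => u v; rewrite !mxE; under eq_fun do rewrite !mxE; exact: HA.
Qed.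

Lemma mx_cvgB m p (A B : T -> 'M[R]_(m, p)) A0 B0 :
  mx_cvg A A0 -> mx_cvg B B0 -> mx_cvg (fun t => A t - B t) (A0 - B0).
Proof.
move=> HA HB i j; rewrite !mxE; under eq_fun do rewrite !mxE.
by apply: cvgB.
Qed.

Lemma mx_cvg_scalar m (a : T -> R) (a0 : R) :
  a t @[t --> F] --> a0 -> mx_cvg (fun t => (a t)%:M : 'M[R]_m) a0%:M.
Proof.
move=> H i j; rewrite mxE; under eq_fun do rewrite mxE.
by case: (i == j) => //=; exact: cvg_cst.
Qed.

Lemma mx_cvg_unique m p (A : T -> 'M[R]_(m, p)) B C : ProperFilter F ->
  mx_cvg A B -> mx_cvg A C -> B = C.
Proof.
move=> PF HB HC; apply/matrixP => i j.
exact: (@cvg_unique _ (@Rhausdorff R) _ _ _ _ (HB i j) (HC i j)).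
Qed.

(* A limit of row vectors lying in the row spaces of frames [G t] lies in the
   row space of the limit frame [G0]: with [G0 *m H = 1], membership of [w] in
   the row space of [G t] implies [w *m (\det (G t *m H) - H *m \adj (G t *m H)
   *m G t) = 0], a closed condition. *)
Lemma row_space_limit m p (w : T -> 'rV[R]_p) w0 (G : T -> 'M[R]_(m, p)) G0 :
  ProperFilter F -> mx_cvg w w0 -> mx_cvg G G0 -> row_free G0 ->
  (\forall t \near F, exists a : 'rV[R]_m, w t = a *m G t) ->
  exists a : 'rV[R]_m, w0 = a *m G0.
Proof.
move=> PF Hw HG /row_freeP[H GH] near_span.
pose Phi (G : 'M[R]_(m, p)) :=
  (\det (G *m H))%:M - H *m \adj (G *m H) *m G : 'M[R]_p.
have cPhi : mx_cvg (fun t => w t *m Phi (G t)) (w0 *m Phi G0).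
  have cGH : mx_cvg (fun t => G t *m H) (G0 *m H).
    by apply: mx_cvg_mul => //; exact: mx_cvg_cst.
  apply: mx_cvg_mul => //; apply: mx_cvgB.
    by apply: mx_cvg_scalar; exact: mx_cvg_det.
  apply: mx_cvg_mul => //; apply: mx_cvg_mul; first exact: mx_cvg_cst.
  exact: mx_cvg_adj.
have c0 : mx_cvg (fun t => w t *m Phi (G t)) 0.
  move=> i j; apply: cvg_near_cst.
  apply: filterS near_span => t [a ->].
  rewrite mulmxBr.
  have -> : a *m G t *m (H *m \adj (G t *m H) *m G t) =
      a *m (G t *m H *m \adj (G t *m H)) *m G t by rewrite !mulmxA.
  by rewrite mul_mx_scalar mul_mx_adj mul_mx_scalar -scalemxAl subrr mxE.
(* At the limit [G0 *m H = 1], so [Phi G0] is [1 - H *m G0] and the coefficients of [w0] are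
   [w0 *m H]. *)
have /eqP := mx_cvg_unique PF cPhi c0.
rewrite /Phi GH det1 adj1 mulmxBr mulmx1 mulmx1 subr_eq0 => /eqP ->.
by exists (w0 *m H); rewrite mulmxA.
Qed.

End MatrixLimits.

Section Pairing.
Context {R : realType} {n : nat} {M : manifold R n}.
Variables (k : nat) (Q : tangent_distribution M).
Hypothesis HQ : regular_distribution k Q.

Lemma vfield_rep_at (X : vfield M) x :
  vfield_rep X (chart_at x) (chart (chart_at x) x) = X x.
Proof. by rewrite vfield_repE ?chart_coord_at//; exact: chart_atP. Qed.

Lemma smooth_vfield_rep (U : set M) (X : vfield M) x i :
  smooth_vfield U X -> U x -> chart_dom i x ->
  smooth_at (vfield_rep X i) (chart i x).
Proof. by move=> HX Ux ix; exact: HX. Qed.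

(** The difference [Z] of the sections vanishes at [x], so its difference quotient at a nearby point
    is a multiple of its value and lies in the span of the frame there. The derivative is the limit
    of these quotients, and [row_space_limit] puts it in [Q x]. *)
Lemma diff_sections_in_distribution (U1 U2 : set M) (X1 X2 : vfield M) x
    (w : 'rV[R]_n) :
  open_nbhs x U1 -> open_nbhs x U2 ->
  smooth_vfield U1 X1 -> smooth_vfield U2 X2 ->
  (forall y, U1 y -> X1 y \in Q y) -> (forall y, U2 y -> X2 y \in Q y) ->
  X1 x = X2 x ->
  'd (vfield_rep X1 (chart_at x)) (chart (chart_at x) x) w -
  'd (vfield_rep X2 (chart_at x)) (chart (chart_at x) x) w \in Q x.
Proof.
move=> oU1 oU2 s1 s2 Q1 Q2 X12; set i := chart_at x; set p := chart i x.
have ix : chart_dom i x by exact: chart_atP.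
have [U [Fr [oU sFr bFr]]] := HQ x.
have d1 : differentiable (vfield_rep X1 i) p.
  by apply: smooth_at_diff; exact: (smooth_vfield_rep s1 oU1.2).
have d2 : differentiable (vfield_rep X2 i) p.
  by apply: smooth_at_diff; exact: (smooth_vfield_rep s2 oU2.2).
pose Z := vfield_rep X1 i - vfield_rep X2 i.
have dZ : differentiable Z p by exact: differentiableB.
have Zp : Z p = 0.
  have E : vfield_rep X1 i p = vfield_rep X2 i p by rewrite !vfield_rep_at.
  by rewrite /Z fctE E subrr.
have DZ : 'D_w Z p = 'd (vfield_rep X1 i) p w - 'd (vfield_rep X2 i) p w.
  have E1 := deriveE w d1.
  have E2 := deriveE w d2.
  apply: (etrans _ (congr2 (fun u v => u - v) E1 E2)).
  by apply: (@deriveB _ _ _ (vfield_rep X1 i) (vfield_rep X2 i));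
    exact: diff_derivable.
rewrite -DZ.
pose G (y : 'rV[R]_n) : 'M[R]_(k, n) := \matrix_(l < k) vfield_rep (Fr l) i y.
have rowG l y : row l (G y) = vfield_rep (Fr l) i y by rewrite rowK.
have /andP[/eqP spF fF] := bFr x oU.2.
have Gp_sum (a : 'rV[R]_k) : a *m G p = \sum_l a 0 l *: [tuple Fr l x | l < k]`_l.
  rewrite mulmx_sum_row; apply: eq_bigr => l _.
  by rewrite rowG vfield_rep_at -tnth_nth tnth_mktuple.
have rG : row_free (G p).
  apply: inj_row_free => a; rewrite Gp_sum => a0.
  by apply/rowP => l; rewrite mxE; move/freeP: fF => /(_ (fun l => a 0 l) a0 l).
have shc : (fun h : R => h *: w + p) @ 0^' --> p.
  rewrite -[X in _ --> X]add0r -(scale0r w).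
  apply: cvgD; last exact: cvg_cst.
  by apply: cvgZ; [exact: nbhs_dnbhs|exact: cvg_cst].
have cZ : mx_cvg (F := 0^') (fun h : R => h^-1 *: Z (h *: w + p)) ('D_w Z p).
  apply: cvg_mx_cvg.
  have -> : (fun h : R => h^-1 *: Z (h *: w + p)) =
      (fun h : R => h^-1 *: ((Z \o shift p) (h *: w) - Z p)).
    by apply/funext => h; rewrite Zp subr0.
  exact: (@diff_derivable _ _ _ Z p w dZ).
have cG : mx_cvg (F := 0^') (fun h : R => G (h *: w + p)) (G p).
  move=> l j; rewrite mxE; under eq_fun do rewrite mxE.
  have cF : {for p, continuous (vfield_rep (Fr l) i)}.
    by apply: smooth_at_continuous; apply: (smooth_vfield_rep (sFr l)) => //; exact: oU.2.
  exact: (cvg_mx_cvg (continuous_cvg _ cF shc)).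
have span : \forall y \near p, exists a : 'rV[R]_k, Z y = a *m G y.
  near=> y.
  have [iz zy] : chart_dom i (chart_inv i y) /\ chart i (chart_inv i y) = y.
    by near: y; exact: near_chart_inv.
  have U1z : U1 (chart_inv i y).
    by near: y; apply: near_chart_inv_dom => //; exact: open_nbhs_nbhs.
  have U2z : U2 (chart_inv i y).
    by near: y; apply: near_chart_inv_dom => //; exact: open_nbhs_nbhs.
  have Uz : U (chart_inv i y).
    by near: y; apply: near_chart_inv_dom => //; exact: open_nbhs_nbhs.
  set z := chart_inv i y in iz zy U1z U2z Uz.
  have /andP[/eqP spz _] := bFr z Uz.
  have XX : X1 z - X2 z \in <<[tuple Fr l z | l < k]>>%VS.
    by rewrite spz; apply: memvB; [exact: Q1|exact: Q2].
  exists (\row_l coord [tuple Fr l z | l < k] l (X1 z - X2 z)).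
  rewrite mulmx_sum_row.
  have -> : Z y = tr_diff (chart_at z) i z (X1 z - X2 z).
    have R1 := vfield_repE X1 iz; have R2 := vfield_repE X2 iz.
    rewrite zy in R1 R2.
    rewrite -[Z y]/(vfield_rep X1 i y - vfield_rep X2 i y) R1 R2.
    by rewrite (tr_diffB _ _ _ (X1 z)).
  rewrite {1}(coord_span XX) tr_diff_sum; apply: eq_bigr => l _.
  have R3 := vfield_repE (Fr l) iz; rewrite zy in R3.
  by rewrite -tnth_nth tnth_mktuple tr_diffZ mxE rowG R3.
have [a ->] : exists a : 'rV[R]_k, 'D_w Z p = a *m G p.
  apply: (row_space_limit _ cZ cG rG).
  have near_h : \forall h \near (0 : R)^', exists a : 'rV[R]_k,
      Z (h *: w + p) = a *m G (h *: w + p) by exact: (shc _ span).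
  apply: filterS near_h => h [a Ea].
  by exists (h^-1 *: a); rewrite Ea -scalemxAl.
rewrite Gp_sum; apply: memv_suml => l _; apply: memvZ.
by rewrite -spF; apply: memv_span; apply: mem_nth; rewrite size_tuple.
Unshelve. all: by end_near. Qed.

(** For two extensions of the same vector the terms differentiating [Y] agree, and the terms
    differentiating the extensions along [Y x] differ by an element of [Q x], which [eta] kills. *)
Lemma pairing_lie (U : set M) (X Y : vfield M) x (eta : cotspace x) :
  open_nbhs x U -> smooth_vfield U X -> (forall y, U y -> X y \in Q y) ->
  (forall v, v \in Q x -> eta v = 0) ->
  pairing Q eta (X x) Y = eta (lie_bracket X Y x).
Proof.
move=> oU sX XQ eta0; rewrite /pairing.
set P := [set r | _].
(* The value computed from [X] inhabits [P], so [get] returns a value coming from some section [X'],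
   possibly another one. *)
have [U' [X' [oU' sX' XQ' X'x ->]]] : P (get P).
  by apply: xgetPex; exists (eta (lie_bracket X Y x)), U, X.
rewrite /lie_bracket !vfield_rep_at X'x.
apply/eqP; rewrite -subr_eq0 -linearB /= opprB [X in _ + X]addrC addrACA.
rewrite subrr add0r addrC.
apply/eqP/eta0.
exact: (diff_sections_in_distribution (Y x) oU oU' sX sX' XQ XQ' (esym X'x)).
Qed.

End Pairing.

(** * Abnormal extremals *)

Section Covectors.
Context {R : realType}.

Lemma deriv_within_dot n (A : set R) (f g : R -> 'rV[R]_n) t (f' g' : 'rV[R]_n) :
  deriv_within A f t f' -> deriv_within A g t g' ->
  deriv_within A (fun s => \sum_j f s 0 j * g s 0 j : R) t
    (\sum_j (f' 0 j * g t 0 j + f t 0 j * g' 0 j)).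
Proof.
have comp (h : R -> 'rV[R]_n) h' j : deriv_within A h t h' ->
    deriv_within A (fun s => h s 0 j : R) t (h' 0 j).
  move=> dh.
  pose L := @coord_fun R n j.
  have Lc : continuous L by exact: coord_continuous.
  have := deriv_within_comp dh (@linear_differentiable _ _ _ L (h t) Lc).
  by rewrite (@diff_lin _ _ _ L).
move=> df dg; apply: deriv_within_sum => j.
exact: (deriv_within_scale (comp _ _ j df) (comp _ _ j dg)).
Qed.

Lemma annihilator_exists n (S : set 'rV[R]_n) :
  linear_span S <> setT ->
  exists p : 'Hom('rV[R]_n, R^o), p != 0 /\ forall v, S v -> p v = 0.
Proof.
move=> nT.
(* [S] may be infinite: a finite family in [S] whose span has maximal dimension already spans all of
   [S]. *)
pose P m := `[< exists s : seq 'rV[R]_n,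
  (forall w, w \in s -> S w) /\ \dim (span s) = m >].
have P0 : exists m, P m.
  by exists (\dim (span ([::] : seq 'rV[R]_n))); apply/asboolP; exists [::].
have Pb m : P m -> (m <= \dim {:'rV[R]_n})%N.
  by move=> /asboolP[s [_ <-]]; apply: dimvS; exact: subvf.
have [m /asboolP[s [sS dims]] maxm] := ex_maxnP P0 Pb.
have SW v : S v -> v \in (span s).
  move=> Sv.
  have sub : (span s <= span (v :: s))%VS by rewrite span_cons addvSr.
  have : (\dim (span (v :: s)) <= m)%N.
    apply: maxm; apply/asboolP; exists (v :: s); split => // w.
    by rewrite inE => /predU1P[->//|/sS].
  rewrite -dims => dimle.
  have /eqP -> : (span s) == (span (v :: s)) by rewrite eqEdim sub.
  by rewrite memv_span// mem_head.
have nW : exists v, v \notin (span s).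
  apply: contrapT => /forallNP H; apply: nT; apply/seteqP; split=> // v _.
  by exists s => //; apply/negPn/negP; exact: H.
have [v vW] := nW.
(* The functional is coordinate [j] of the component complementary to the span; it vanishes on the
   span and not at [v]. *)
have /rV0Pn[j vj] : v - projv (span s) v != 0.
  by apply: contra vW; rewrite subr_eq0 => /eqP ->; exact: memv_proj.
have lin : linear (fun u : 'rV[R]_n => (u - projv (span s) u) 0 j : R^o).
  by move=> z x y; rewrite linearP !mxE /GRing.scale /=; ring.
pose L : {linear 'rV[R]_n -> R^o} :=
  HB.pack (fun u : 'rV[R]_n => (u - projv (span s) u) 0 j : R^o)
    (GRing.isLinear.Build _ _ _ _ _ lin).
exists (linfun L); split.
  apply/eqP => /(congr1 (fun f : 'Hom('rV[R]_n, R^o) => f v)).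
  by rewrite lfunE zero_lfunE; apply/eqP.
by move=> w /SW wW; rewrite lfunE /= projv_id// subrr mxE.
Qed.

Context {n : nat} {M : manifold R n}.

(** Along a curve this turns a pairing at moving base points into a dot product in one fixed chart,
    to which the product rule [deriv_within_dot] applies. *)
Lemma cocoord_sum (x : M) i (eta : cotspace x) (w : 'rV[R]_n) : chart_dom i x ->
  eta w = \sum_j cocoord i eta 0 j * (tr_diff (chart_at x) i x w) 0 j.
Proof.
move=> ix; have ax := chart_atP x.
rewrite -{1}(tr_diffK w ax ix) {1}(row_sum_delta (tr_diff (chart_at x) i x w)).
rewrite tr_diff_sum linear_sum; apply: eq_bigr => j _.
by rewrite mxE tr_diffZ linearZ mulrC.
Qed.

Lemma cocoord_at_sum (x : M) (eta : cotspace x) (w : 'rV[R]_n) :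
  eta w = \sum_j cocoord (chart_at x) eta 0 j * w 0 j.
Proof.
rewrite (cocoord_sum eta w (chart_atP x)).
by apply: eq_bigr => j _; rewrite tr_diff_id//; exact: chart_atP.
Qed.

End Covectors.

(** * Transport of covectors along the curve *)

Section Transport.
Context {R : realType} {n : nat} {M : manifold R n}.
Variables (k : nat) (Q : tangent_distribution M).
Variables (HQ : regular_distribution k Q).
Variables (a b : R) (Hab : a < b) (c : R -> M).
Variables (U : set M) (X : vfield M) (HU : open U).
Variables (HcU : forall t, a <= t <= b -> U (c t)).
Variables (HX : smooth_vfield U X) (HXQ : forall x, U x -> X x \in Q x).
Variables (HcX : integral_curve a b X c).
Variables (D : set (R * M)) (phi : R -> M -> M) (Hphi : local_flow U X D phi).

Let x0 := c a.
Let i0 := chart_at x0.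

Lemma flowE t : a <= t <= b -> D (t - a, x0) /\ phi (t - a) x0 = c t.
Proof. exact: (flow_integral_curve Hphi (ltW Hab) HcU HcX). Qed.

Lemma within_curve_cvg t : a <= t <= b -> c @ within `[a, b] (nbhs t) --> c t.
Proof. by move=> /HcX[]. Qed.

Lemma near_curve_chart t i : a <= t <= b -> chart_dom i (c t) ->
  \forall s \near t, a <= s <= b -> chart_dom i (c s).
Proof.
move=> tab it.
have H : \forall s \near t, `[a, b]%classic s -> chart_dom i (c s).
  exact: (within_curve_cvg tab (near_chart_dom it)).
by apply: filterS H => s H sab; apply: H; rewrite /= in_itv.
Qed.

Lemma curve_deriv t i : a <= t <= b -> chart_dom i (c t) ->
  deriv_within `[a, b] (chart i \o c) t (vfield_rep X i (chart i (c t))).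
Proof. by move=> tab it; rewrite vfield_repE//; exact: (velocity_chart (HcX tab)). Qed.

Lemma curve_open_nbhs t : a <= t <= b -> open_nbhs (c t) U.
Proof. by move=> /HcU. Qed.

Lemma dphi_curve t i v : a <= t <= b -> chart_dom i (c t) ->
  tr_diff (chart_at (c t)) i (c t) (dphi phi i0 (chart_at (c t)) (t - a) x0 v) =
  dphi phi i0 i (t - a) x0 v.
Proof.
move=> tab; have [Dt <-] := flowE tab => it.
by rewrite -(dphi_target Hphi)//; exact: chart_atP.
Qed.

Lemma transport_deriv t i v : a <= t <= b -> chart_dom i (c t) ->
  deriv_within `[a, b] (fun s => dphi phi i0 i (s - a) x0 v) t
    ('d (vfield_rep X i) (chart i (c t)) (dphi phi i0 i (t - a) x0 v)).
Proof.
move=> tab it; have [Dt pt] := flowE tab.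
have it' : chart_dom i (phi (t - a) x0) by rewrite pt.
have := @dphi_variational _ _ _ _ _ _ _ HX Hphi i0 i (t - a) x0 v Dt (chart_atP x0) it'.
rewrite pt => /(is_derive_deriv_within setT).
move=> /(@deriv_within_shift R 'rV[R]_n _ (fun r => dphi phi i0 i r x0 v) t (- a)).
by apply: deriv_within_eq => //; exact: near_all.
Qed.

Lemma dot_diff (x : M) (eta : cotspace x) (L : {linear 'rV[R]_n -> 'rV[R]_n})
    (w : 'rV[R]_n) :
  \sum_j - eta (L (delta_mx 0 j)) * w 0 j = - eta (L w).
Proof.
have -> : eta (L w) = \sum_j w 0 j * eta (L (delta_mx 0 j)).
  rewrite {1}(row_sum_delta w) [X in eta X]linear_sum linear_sum /=.
  by apply: eq_bigr => j _; rewrite [X in eta X]linearZ linearZ.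
by rewrite -sumrN; apply: eq_bigr => j _; rewrite mulNr mulrC.
Qed.

Lemma covector_transport (psi : forall t, cotspace (c t)) v :
  (forall t, a <= t <= b -> let i := chart_at (c t) in
     deriv_within `[a, b] (fun s => cocoord i (psi s)) t
     (\row_j - psi t ('d (vfield_rep X i) (chart i (c t)) (delta_mx 0 j)))) ->
  forall t, a <= t <= b ->
    psi t (dphi phi i0 (chart_at (c t)) (t - a) x0 v) = psi a v.
Proof.
move=> ode.
have aab : a <= a <= b by rewrite lexx ltW.
pose g t : R := psi t (dphi phi i0 (chart_at (c t)) (t - a) x0 v).
have ga : g a = psi a v.
  by rewrite /g subrr (dphi0 Hphi)//; [exact: HcU|exact: chart_atP].
rewrite -ga; apply: (deriv_within_cst_itv Hab) => t tab.
pose i := chart_at (c t); have it : chart_dom i (c t) by exact: chart_atP.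
have := deriv_within_dot (ode t tab) (transport_deriv (v := v) tab it).
(* [g] uses the preferred chart at each [c s]; near [t] it equals the dot product in the single
   chart [i], whose derivative is known. *)
have gE s : a <= s <= b -> chart_dom i (c s) ->
    \sum_j cocoord i (psi s) 0 j * dphi phi i0 i (s - a) x0 v 0 j = g s.
  by move=> sab is_; rewrite /g (cocoord_sum (psi s) _ is_) dphi_curve.
rewrite (_ : \sum_j _ = 0).
  apply: deriv_within_eq; last exact: gE.
  have := near_curve_chart tab it; apply: filterS => s H.
  rewrite /= in_itv /= => sab; split => //.
  by apply: gE => //; exact: H.
rewrite big_split /= -cocoord_at_sum.
under eq_bigr do rewrite mxE.
by rewrite dot_diff addNr.
Qed.

Lemma lie_bracketE (Y : vfield M) x : let i := chart_at x in
  lie_bracket X Y x =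
  'd (vfield_rep Y i) (chart i x) (vfield_rep X i (chart i x)) -
  'd (vfield_rep X i) (chart i x) (vfield_rep Y i (chart i x)).
Proof. by []. Qed.

(* The test fields are [r *: e_j] in a chart, where [r] is a bump function.  It
   need not be constant near the point: the terms in [dr] cancel. *)
Lemma adjoint_equation (psi : forall t, cotspace (c t)) :
  (forall t v, a <= t <= b -> v \in Q (c t) -> psi t v = 0) ->
  (forall Y, smooth_vfield setT Y ->
    forall t (v : tspace (c t)), a <= t <= b -> @velocity R n M `[a, b] c t v ->
    deriv_within `[a, b] (fun s => psi s (Y (c s)) : R) t
      (pairing Q (psi t) v Y)) ->
  forall t, a <= t <= b -> let i := chart_at (c t) in
    deriv_within `[a, b] (fun s => cocoord i (psi s)) t
    (\row_j - psi t ('d (vfield_rep X i) (chart i (c t)) (delta_mx 0 j))).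
Proof.
move=> ann eqn t tab; have it := chart_atP (c t).
set i := chart_at (c t) in it *; set p := chart i (c t).
apply: deriv_within_mx => j.
have [Y [r [sY sr r0 YE]]] := exists_bump_vfield j it.
have dr : differentiable r p by exact: smooth_at_diff.
have df := eqn Y sY t (X (c t)) tab (HcX tab).
rewrite (pairing_lie HQ Y (curve_open_nbhs tab) HX HXQ (ann t ^~ tab)) in df.
(* Near [t], where [r] does not vanish along [c], component [j] of [psi] is [psi s (Y (c s))]
   divided by [r]; hence the product rule with the inverse of [r]. *)
have dq : differentiable (fun y => (r y)^-1) p by exact: differentiableV.
have da := deriv_within_comp (curve_deriv tab it) dq.
pose e : 'rV[R]_n := delta_mx 0 j.
have Yrep : \forall y \near p, r y *: e = vfield_rep Y i y.
  near=> y.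
  have [iy py] : chart_dom i (chart_inv i y) /\ chart i (chart_inv i y) = y.
    by near: y; exact: near_chart_inv.
  rewrite -{2}py vfield_repE// YE// chart_coordE tr_diffZ -chart_coordE.
  by rewrite of_chart_coordK// py.
have dYE u : 'd (vfield_rep Y i) p u = 'd r p u *: e.
  have [_ E1] := @near_eq_diff _ _ _ (fun y => r y *: e)
    (vfield_rep Y i) p Yrep (differentiableZl (e) dr).
  have E2 := congr1 (fun F => F u) (diffZl (e) dr).
  exact: (etrans (congr1 (fun F => F u) E1) E2).
have dqE u : 'd (fun y => (r y)^-1) p u = - (r p) ^- 2 * 'd r p u.
  have E1 := deriveE u dq.
  have E2 := deriveE u dr.
  rewrite -E1 deriveV//; last exact: diff_derivable.
  by rewrite -E2.
pose w := vfield_rep X i p.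
have ft : psi t (Y (c t)) = r p * psi t e.
  by rewrite YE// linearZ of_chart_coordE tr_diff_id.
have lieE : psi t (lie_bracket X Y (c t)) =
    'd r p w * psi t e - r p * psi t ('d (vfield_rep X i) p e).
  have -> : lie_bracket X Y (c t) = 'd r p w *: e - r p *: 'd (vfield_rep X i) p e.
    have E1 : vfield_rep Y i p = r p *: e by exact: (esym (nbhs_singleton Yrep)).
    have E2 : 'd (vfield_rep X i) p (vfield_rep Y i p) = r p *: 'd (vfield_rep X i) p e.
      by rewrite E1 linearZ.
    exact: (congr2 (fun u v => u - v) (dYE w) E2).
  by rewrite linearB /= !linearZ.
have := deriv_within_scale da df.
rewrite /= dqE lieE ft -/p -/w mxE.
set l := (X in deriv_within _ _ _ X).
have -> : l = - psi t ('d (vfield_rep X i) p e).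
  by rewrite /l /GRing.scale /=; field.
apply: deriv_within_eq; last first.
  rewrite /= -/p ft mxE of_chart_coordE tr_diff_id// /GRing.scale /= mulrA mulVf// mul1r.
  by [].
have rne0 : \forall y \near c t, r (chart i y) != 0.
  have rc : {for c t, continuous (r \o chart i)}.
    apply: continuous_comp; first exact: chart_continuous.
    exact: differentiable_continuous.
  have /= := cvgr_neq0 _ rc r0; exact.
have rne : \forall s \near t, `[a, b]%classic s -> r (chart i (c s)) != 0.
  exact: (within_curve_cvg tab rne0).
near=> s => sab; split; first exact: sab.
have is_ : chart_dom i (c s).
  by move: sab; rewrite /= in_itv /=; near: s; exact: near_curve_chart.
have rs : r (chart i (c s)) != 0 by move: sab; near: s; exact: rne.
by rewrite /= YE// linearZ mxE /GRing.scale /= mulrA mulVf// mul1r.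
Unshelve. all: by end_near. Qed.

(** [tmap (phi (- s)) Y] lives at [phi (- s) (c (a + s))], which is only provably equal to [c a].
    Rewriting this base point makes the target chart the fixed [i0]. *)
Lemma pullback_memE (e : 'rV[R]_n) s (Y : tspace (c (a + s))) :
  a - a <= s <= b - a -> e = tmap (phi (- s)) Y ->
  a <= a + s <= b /\
  e = dphi phi (chart_at (c (a + s))) i0 (- s) (c (a + s)) Y.
Proof.
move=> /andP[]; rewrite subrr => s0 sL ->.
have tab : a <= a + s <= b by rewrite lerDl s0 addrC -lerBrDr.
have [Dt pt] := flowE tab; rewrite addrAC subrr add0r in Dt pt.
have [_ pm] := flow_opp Hphi Dt; rewrite pt in pm.
split; first exact: tab.
rewrite tmap_dphi.
rewrite pm.
reflexivity.
Qed.

(** The flow carries a generator [e] to a vector [Y] of [Q], so [psi a e] equals [psi (a + s) Y],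
    which is 0; the kernel of [psi a] then contains every span of generators. *)
Lemma abnormal_pullback_proper (psi : forall t, cotspace (c t)) :
  (forall t v, a <= t <= b -> v \in Q (c t) -> psi t v = 0) ->
  (forall t, a <= t <= b -> let i := chart_at (c t) in
    deriv_within `[a, b] (fun s => cocoord i (psi s)) t
    (\row_j - psi t ('d (vfield_rep X i) (chart i (c t)) (delta_mx 0 j)))) ->
  forall w, pullback_space Q phi a b c a w -> psi a w = 0.
Proof.
move=> ann ode w [S HS wS].
have gen e : e \in S -> psi a e = 0.
  move=> /HS [s [Y [sab YQ eE]]].
  have [tab {}eE] := pullback_memE sab eE.
  have [Dt pt] := flowE tab.
  have tE : a + s - a = s by rewrite addrAC subrr add0r.
  have it : chart_dom (chart_at (c (a + s))) (phi s x0).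
    by rewrite -[in phi s _]tE pt; exact: chart_atP.
  rewrite tE in Dt pt.
  have := dphiVK Hphi Y Dt (chart_atP x0) it; rewrite pt -eE => dY.
  rewrite -(covector_transport e ode tab) tE dY.
  exact: ann.
have sub : (span S <= lker (psi a))%VS.
  by apply/span_subvP => e /gen e0; rewrite memv_ker e0.
by apply/eqP; rewrite -memv_ker; exact: (subvP sub).
Qed.

(** * The extremal built from a covector at the initial point *)

Section Pulled.
Variable p : 'Hom('rV[R]_n, R^o).

(** The base point is a parameter separate from the time, so that one definition serves over [c t]
    and over the flow line [e t], which prolongs [c] smoothly beyond [[a, b]]. *)
Definition pulled_covector (x : M) (t : R) : cotspace x :=
  linfun (p \o dphi phi (chart_at x) i0 (- (t - a)) x).

Lemma pulled_covectorE x t v :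
  pulled_covector x t v = p (dphi phi (chart_at x) i0 (- (t - a)) x v).
Proof. by rewrite lfunE. Qed.

Let e t := phi (t - a) x0.

Lemma pulled_covector_transport t v : D (t - a, x0) ->
  pulled_covector (e t) t (dphi phi i0 (chart_at (e t)) (t - a) x0 v) = p v.
Proof.
move=> Dt; rewrite pulled_covectorE (dphiK Hphi)//; exact: chart_atP.
Qed.

Lemma smooth_at_affine t : smooth_at (fun s : R => (s - a, chart i0 x0)) t.
Proof.
apply: smooth_at_pair; [exact: finite_coords_R|exact: finite_coords_rV| |].
  have -> : (fun s : R => s - a) = (idfun : R -> R) + cst (- a) by [].
  apply: smooth_atD; last exact: smooth_at_cst.
  by apply: (@smooth_at_linear R R R idfun) => y; exact: cvg_id.
exact: smooth_at_cst.
Qed.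

Lemma flow_curve_continuous t : D (t - a, x0) -> {for t, continuous e}.
Proof.
move=> Dt; have [H _] := flow_smooth Hphi Dt (chart_atP x0).
have -> : e = (fun z : R * 'rV[R]_n => phi z.1 (chart_inv i0 z.2)) \o
    (fun s : R => (s - a, chart i0 x0)).
  by apply/funext => s; rewrite /e /= chartK//; exact: chart_atP.
apply: continuous_comp; last exact: H.
exact: smooth_at_continuous (smooth_at_affine t).
Qed.

Lemma flow_curve_smooth t i : D (t - a, x0) -> chart_dom i (e t) ->
  smooth_at (chart i \o e) t.
Proof.
move=> Dt it.
have -> : chart i \o e = flow_rep phi i0 i \o (fun s : R => (s - a, chart i0 x0)).
  by apply/funext => s; rewrite /e /flow_rep /= chartK//; exact: chart_atP.
apply: smooth_at_comp; last 1 first.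
- by apply: (smooth_flow_rep Hphi Dt) => //; exact: chart_atP.
- by apply: finite_coords_prod; [exact: finite_coords_R|exact: finite_coords_rV].
- exact: smooth_at_affine.
Qed.

Lemma near_flow_curve t i : D (t - a, x0) -> chart_dom i (e t) ->
  \forall s \near t, D (s - a, x0) /\ chart_dom i (e s).
Proof.
move=> Dt it.
have N1 : \forall s \near t, D (s - a, x0).
  have sc : {for t, continuous (fun s : R => s - a)}.
    by apply: cvgB; [exact: cvg_id|exact: cvg_cst].
  exact: (sc _ (flow_fiber_nbhs Hphi Dt)).
have N2 : \forall s \near t, chart_dom i (e s).
  exact: (flow_curve_continuous Dt (near_chart_dom it)).
by apply: filterS2 N1 N2.
Qed.

Lemma smooth_at_covector (y : 'rV[R]_n) : smooth_at (fun v => p v : R) y.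
Proof.
have -> : (fun v => p v : R) =
    \sum_j (fun v : 'rV[R]_n => (v 0 j) *: (p (delta_mx 0 j) : R)).
  apply/funext => v; rewrite fct_sumE {1}(row_sum_delta v) linear_sum.
  by apply: eq_bigr => j _; rewrite linearZ.
apply: smooth_at_sum => j; apply: smooth_at_scale; last exact: smooth_at_cst.
pose L := @coord_fun R n j.
by apply: (@smooth_at_linear R _ _ L); exact: coord_continuous.
Qed.

(** Exhibits the components through a space derivative of the smooth map [flow_rep] at a point
    moving smoothly with [s], whence their smoothness. *)
Lemma pulled_covector_cocoord s i j : D (s - a, x0) -> chart_dom i (e s) ->
  cocoord i (pulled_covector (e s) s) 0 j =
  p ('D_(0, delta_mx 0 j) (flow_rep phi i i0) (- (s - a), chart i (e s))).
Proof.
move=> Ds is_; rewrite mxE pulled_covectorE of_chart_coordE.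
have [Dm pm] := flow_opp Hphi Ds.
have im : chart_dom i0 (phi (- (s - a)) (e s)) by rewrite pm; exact: chart_atP.
rewrite -(dphi_source Hphi)//; last exact: chart_atP.
by rewrite (dphi_partial Hphi).
Qed.

Lemma pulled_covector_smooth t : D (t - a, x0) ->
  smooth_covector_at (fun s => pulled_covector (e s) s) t.
Proof.
move=> Dt; split.
  split; first exact: flow_curve_continuous.
  by move=> i it; exact: flow_curve_smooth.
move=> i it.
apply: (@smooth_at_near _ _ _ (\sum_j (fun s =>
  (p ('D_(0, delta_mx 0 j) (flow_rep phi i i0) (- (s - a), chart i (e s))) : R) *:
   (delta_mx 0 j : 'rV[R]_n)))).
  apply: filterS (near_flow_curve Dt it) => s [Ds is_].
  rewrite fct_sumE [RHS]row_sum_delta; apply: eq_bigr => j _.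
  by rewrite pulled_covector_cocoord.
apply: smooth_at_sum => j; apply: smooth_at_scale; last exact: smooth_at_cst.
apply: (@smooth_at_comp _ _ _ _ (fun s =>
  'D_(0, delta_mx 0 j) (flow_rep phi i i0) (- (s - a), chart i (e s)))
  (fun v => p v : R)).
- exact: finite_coords_rV.
- have [Dm pm] := flow_opp Hphi Dt.
  have im : chart_dom i0 (phi (- (t - a)) (e t)) by rewrite pm; exact: chart_atP.
  apply: (@smooth_at_comp _ _ _ _ (fun s => (- (s - a), chart i (e s)))
    ('D_(0, delta_mx 0 j) (flow_rep phi i i0))).
  + by apply: finite_coords_prod; [exact: finite_coords_R|exact: finite_coords_rV].
  + apply: smooth_at_pair; [exact: finite_coords_R|exact: finite_coords_rV| |].
      have -> : (fun s : R => - (s - a)) =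
          (fun s : R => (cst (-1) s) *: (idfun s : R)) + cst a.
        by apply/funext => s; rewrite !fctE /= opprB scaleN1r addrC.
      apply: smooth_atD; last exact: smooth_at_cst.
      apply: smooth_at_scale; first exact: smooth_at_cst.
      by apply: (@smooth_at_linear R R R idfun) => y; exact: cvg_id.
    exact: flow_curve_smooth.
  + by apply: smooth_at_derive; exact: (smooth_flow_rep Hphi Dm it im).
- exact: smooth_at_covector.
Qed.

Let psi t := pulled_covector (c t) t.

Lemma pulled_cocoord_curve t i : a <= t <= b ->
  cocoord i (pulled_covector (e t) t) = cocoord i (psi t).
Proof. by move=> /flowE[_ pt]; rewrite /e pt. Qed.

(** Only existence matters here; [pulled_adjoint_equation] determines the value. *)
Lemma pulled_cocoord_deriv t i : a <= t <= b -> chart_dom i (c t) ->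
  exists f' : 'rV[R]_n, deriv_within `[a, b] (fun s => cocoord i (psi s)) t f'.
Proof.
move=> tab it; have [Dt pt] := flowE tab.
have [_ H] := pulled_covector_smooth Dt.
have /smooth_at_diff/derivable1_diffP/derivableP df :
    smooth_at (fun s => cocoord i (pulled_covector (e s) s)) t.
  by apply: H; rewrite /e pt.
exists ('D_1 (fun s => cocoord i (pulled_covector (e s) s)) t).
have := is_derive_deriv_within `[a, b] df.
apply: deriv_within_eq; last exact: pulled_cocoord_curve.
apply: near_all => s sab; split; first exact: sab.
by apply: pulled_cocoord_curve; move: sab; rewrite /= in_itv.
Qed.

(** Any [w] at [c t] is the transport of some [v] at [c a]. Pairing the covector curve with the
    transports of [v] gives the constant [p v], and the product rule for its zero derivative is the
    claim. *)
Lemma pulled_adjoint_equation t (f' w : 'rV[R]_n) :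
  a <= t <= b -> let i := chart_at (c t) in
  deriv_within `[a, b] (fun s => cocoord i (psi s)) t f' ->
  \sum_j f' 0 j * w 0 j = - psi t ('d (vfield_rep X i) (chart i (c t)) w).
Proof.
move=> tab i df; have it : chart_dom i (c t) by exact: chart_atP.
have [Dt pt] := flowE tab.
have it' : chart_dom i (phi (t - a) x0) by rewrite pt.
pose v := dphi phi i i0 (- (t - a)) (c t) w.
have vw : dphi phi i0 i (t - a) x0 v = w.
  by have := dphiVK Hphi w Dt (chart_atP x0) it'; rewrite pt.
have dA := transport_deriv (v := v) tab it.
have := deriv_within_dot df dA; rewrite vw => dS.
have cE s : a <= s <= b -> chart_dom i (c s) ->
    \sum_j cocoord i (psi s) 0 j * dphi phi i0 i (s - a) x0 v 0 j = p v.
  move=> sab is_; have [Ds ps] := flowE sab.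
  rewrite -(dphi_curve v sab is_) -cocoord_sum// /psi.
  by have := pulled_covector_transport v Ds; rewrite /e ps.
have dC : deriv_within `[a, b] (fun=> p v : R) t
    (\sum_j (f' 0 j * w 0 j + cocoord i (psi t) 0 j *
       'd (vfield_rep X i) (chart i (c t)) w 0 j)).
  apply: deriv_within_eq dS; last exact: cE.
  have := near_curve_chart tab it; apply: filterS => s H.
  rewrite /= in_itv /= => sab; split => //.
  by apply: cE => //; exact: H.
have := deriv_within_unique (within_dnbhs_itv_proper Hab tab) dC
  (deriv_within_cst _ (p v : R) t).
rewrite big_split /= -cocoord_at_sum => /eqP.
by rewrite addr_eq0 => /eqP.
Qed.

(** The velocity is forced to be [X (c t)]. The product rule gives one term differentiating [Y]
    along [X] and, by the adjoint equation, minus one differentiating [X] along [Y]: together the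
    bracket. *)
Lemma pulled_equation (Y : vfield M) t (v : tspace (c t)) :
  (forall t v, a <= t <= b -> v \in Q (c t) -> psi t v = 0) ->
  smooth_vfield setT Y -> a <= t <= b -> @velocity R n M `[a, b] c t v ->
  deriv_within `[a, b] (fun s => psi s (Y (c s)) : R) t (pairing Q (psi t) v Y).
Proof.
move=> ann sY tab [_ vd]; have it := chart_atP (c t).
have [_ Xd] := HcX tab.
have -> : v = X (c t).
  exact: (deriv_within_unique (within_dnbhs_itv_proper Hab tab) vd Xd).
rewrite (pairing_lie HQ Y (curve_open_nbhs tab) HX HXQ (ann t ^~ tab)).
set i := chart_at (c t) in it; pose q := chart i (c t).
have [f' df] := pulled_cocoord_deriv tab it.
have dY : differentiable (vfield_rep Y i) q by apply: smooth_at_diff; exact: sY.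
have dy := deriv_within_comp (curve_deriv tab it) dY.
have yE s : a <= s <= b -> chart_dom i (c s) ->
    \sum_j cocoord i (psi s) 0 j * (vfield_rep Y i \o (chart i \o c)) s 0 j =
    psi s (Y (c s)).
  by move=> sab is_; rewrite (cocoord_sum (psi s) _ is_) /= vfield_repE.
have dS := deriv_within_dot df dy.
have lieE : psi t (lie_bracket X Y (c t)) =
  \sum_j (f' 0 j * (vfield_rep Y i \o (chart i \o c)) t 0 j +
    cocoord i (psi t) 0 j *
    'd (vfield_rep Y i) ((chart i \o c) t) (vfield_rep X i (chart i (c t))) 0 j).
  rewrite big_split /= (pulled_adjoint_equation _ tab df)// -cocoord_at_sum.
  by rewrite lie_bracketE linearB /= addrC.
refine (eq_ind_r (fun l : R =>
  deriv_within `[a, b] (fun s => psi s (Y (c s)) : R) t l) _ lieE).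
apply: deriv_within_eq dS; last first.
  exact: (yE t tab it).
have := near_curve_chart tab it; apply: filterS => s H.
rewrite /= in_itv /= => sab; split => //.
by apply: yE => //; exact: H.
Qed.

Lemma pulled_annihilates :
  (forall w, [set w | exists s (Y : tspace (c (a + s))),
    [/\ a - a <= s <= b - a, Y \in Q (c (a + s)) & w = tmap (phi (- s)) Y]] w ->
    p w = 0) ->
  forall t v, a <= t <= b -> v \in Q (c t) -> psi t v = 0.
Proof.
move=> p0 t v tab vQ; pose s := t - a; have tE : a + s = t by rewrite addrC subrK.
(* The pullback space indexes points as [c (a + s)]; generalizing over [u] allows [a + s] to be
   rewritten to [t] in the types. *)
suff key (u : tspace (c (a + s))) : u \in Q (c (a + s)) -> psi (a + s) u = 0.
  by move: key; rewrite tE; apply.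
move=> uQ; rewrite /psi pulled_covectorE.
have sab : a - a <= s <= b - a by rewrite !lerD2r.
have [_ uE] := pullback_memE sab (erefl (tmap (phi (- s)) u)).
have sE : a + s - a = s by rewrite addrAC subrr add0r.
rewrite sE; apply: (etrans (congr1 p (esym uE))).
apply: p0; exists s, u.
by split; [exact: sab|exact: uQ|reflexivity].
Qed.

(** Composing [psi t] with the differential of the flow gives back [p]. *)
Lemma pulled_neq0 t : p != 0 -> a <= t <= b -> psi t != 0.
Proof.
move=> p0 tab; have [Dt pt] := flowE tab.
apply: contra p0 => /eqP psi0; apply/eqP/lfunP => v.
have := pulled_covector_transport v Dt.
by rewrite /e pt -/(psi t) psi0 !zero_lfunE.
Qed.

Lemma pulled_continuous : continuous_covector a b psi.
Proof.
move=> t tab; split; first exact: within_curve_cvg.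
move=> i it; have [Dt pt] := flowE tab.
have [_ H] := pulled_covector_smooth Dt.
have it' : chart_dom i (e t) by rewrite /e pt.
have cc := smooth_at_continuous (H i it').
have cw : cocoord i (pulled_covector (e s) s) @[s --> within `[a, b] (nbhs t)] -->
    cocoord i (psi t).
  rewrite -pulled_cocoord_curve//; by apply: cvg_within_filter; exact: cc.
apply: cvg_trans cw; apply: near_eq_cvg.
have H' : \forall s \near t, `[a, b]%classic s ->
    cocoord i (pulled_covector (e s) s) = cocoord i (psi s).
  apply: near_all => s; rewrite /= in_itv /=; exact: pulled_cocoord_curve.
exact: H'.
Qed.

(** The flow line of [c a] exists slightly before time 0 and slightly after [b - a], so the covector
    curve over [e] is the required smooth extension, and a single piece suffices. *)
Lemma pulled_covector_curve : covector_curve psi a b.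
Proof.
have aab : a <= a <= b by rewrite lexx ltW.
have bab : a <= b <= b by rewrite lexx ltW.
have [Da _] := flowE aab.
have [Db _] := flowE bab.
have /nbhs_ballP[e1 /= e10 He1] := flow_fiber_nbhs Hphi Da.
have /nbhs_ballP[e2 /= e20 He2] := flow_fiber_nbhs Hphi Db.
exists (a - e1), (b + e2), e, (fun s => pulled_covector (e s) s); split.
- by rewrite ltrBlDr ltrDl.
- by rewrite ltrDl.
- move=> t /andP[at_ tb]; apply: pulled_covector_smooth.
  have [ta|ta] := ltP t a.
    apply: He1; rewrite /ball /= subrr sub0r normrN ltr0_norm ?subr_lt0//.
    by rewrite opprB ltrBlDl -ltrBlDr.
  have [bt|bt] := ltP b t.
    apply: He2; rewrite /ball /= opprB addrA subrK ltr0_norm ?subr_lt0//.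
    by rewrite opprB ltrBlDl.
  by have [] := flowE (t := t); rewrite ?ta.
- by move=> t /flowE[_ pt]; rewrite /e pt.
Qed.

End Pulled.

Lemma piecewise_single (P : R -> R -> Prop) : P a b -> piecewise P a b.
Proof.
by move=> Pab; exists 1%N, (fun i => if i is 0%N then a else b); split => // -[|].
Qed.

Lemma abnormal_sufficient : curve c a b -> tangent_to Q a b c ->
  pullback_space Q phi a b c a <> [set: tspace (c a)] ->
  abnormal_extremal Q a b c.
Proof.
move=> Hc Htan /annihilator_exists[p [p0 pS]]; split.
- by apply/subspace_continuousP => t; rewrite /= in_itv /=; exact: within_curve_cvg.
- exact: piecewise_single.
- exact: Htan.
- have ann := pulled_annihilates pS.
  exists (fun t => pulled_covector p (c t) t); split.
  + exact: pulled_continuous.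
  + by apply: piecewise_single; exact: pulled_covector_curve.
  + by move=> t; exact: pulled_neq0.
  + exact: ann.
  + by move=> Y sY t v tab vel; exact: pulled_equation.
Qed.

Lemma abnormal_necessary : abnormal_extremal Q a b c ->
  pullback_space Q phi a b c a <> [set: tspace (c a)].
Proof.
move=> [_ _ _ [psi [_ _ psi0 ann eqn]]] pT.
have ode := adjoint_equation ann eqn.
have aab : a <= a <= b by rewrite lexx ltW.
have /negP[] := psi0 a aab.
apply/eqP/lfunP => w; rewrite zero_lfunE.
by apply: (abnormal_pullback_proper ann ode); rewrite pT.
Qed.

End Transport.

Unset Implicit Arguments.
Set Strict Implicit.
Set Printing Implicit Defensive.

Theorem theorem24 (R : realType) (n : nat) (M : manifold R n)
    (k : nat) (Q : tangent_distribution M)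
    (HQ : regular_distribution k Q) (HQni : ~ integrable_distribution k Q)
    (a b : R) (Hab : a < b) (c : R -> M)
    (Hc : curve c a b) (Himm : immersed a b c) (Htan : tangent_to Q a b c)
    (U : set M) (X : vfield M) (HU : open U)
    (HcU : forall t, a <= t <= b -> U (c t))
    (HX : smooth_vfield U X) (HXQ : forall x, U x -> X x \in Q x)
    (HcX : integral_curve a b X c)
    (D : set (R * M)) (phi : R -> M -> M) (Hphi : local_flow U X D phi) :
  abnormal_extremal Q a b c <->
  pullback_space Q phi a b c a <> [set: tspace (c a)].
Proof.
split; first exact: (abnormal_necessary HQ Hab HU HcU HX HXQ HcX Hphi).
exact: (abnormal_sufficient HQ Hab HU HcU HX HXQ HcX Hphi Hc Htan).
Qed.
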